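(* Let $(P,Q,H)$ be a matched triple, and let $(\pi,X)$ be a faithful representation of the outer algebra $o(P,Q,H)$. Then there exists a faithful representation $(\widetilde{\pi},X)$ of the inner algebra $i(P,Q,H)$, on the same Hilbert space $X$, such that $\widetilde{\pi}(I)=\pi(I)$ and $$\widetilde{\pi}(P-P\wedge Q)=\pi(P)-\pi(P)\wedge\pi(Q),\qquad \widetilde{\pi}(Q-P\wedge Q)=\pi(Q)-\pi(P)\wedge\pi(Q).$$
   Context: For a Hilbert $C^*$-module $H$, $\mathcal{L}(H)$ denotes the $C^*$-algebra of all adjointable operators on $H$, and $I$ its unit. A projection is $P\in\mathcal{L}(H)$ with $P=P^*=P^2$. A closed submodule $M\subseteq H$ is orthogonally complemented in $H$ if $H=M+M^\perp$; then $P_M$ denotes the projection in $\mathcal{L}(H)$ with range $M$. A triple $(P,Q,H)$ is matched if $H$ is a Hilbert $C^*$-module and $P,Q$ are projections on $H$ such that $\mathcal{R}=\mathcal{R}(Q)\cap\mathcal{R}(P)$ (intersection of the ranges) is orthogonally complemented in $H$. In this case $P\wedge Q:=P_{\mathcal{R}}$. The inner algebra $i(P,Q,H)$ is the $C^*$-subalgebra of $\mathcal{L}(H)$ generated by $\{P-P\wedge Q,\ Q-P\wedge Q,\ I\}$; the outer algebra $o(P,Q,H)$ is the $C^*$-subalgebra of $\mathcal{L}(H)$ generated by $\{P,\ Q,\ P\wedge Q,\ I\}$. A representation $(\pi,X)$ of a $C^*$-algebra $\mathfrak{A}$ consists of a Hilbert space $X$ and a $*$-homomorphism $\pi:\mathfrak{A}\to\mathbb{B}(X)$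 into the bounded linear operators on $X$; it is faithful if $\pi$ is injective. For projections on the Hilbert space $X$, $\pi(P)\wedge\pi(Q)$ is the orthogonal projection of $X$ onto $\mathcal{R}(\pi(P))\cap\mathcal{R}(\pi(Q))$ (it may differ from $\pi(P\wedge Q)$). *)

(* Defs.v *)
From HB Require Import structures.
From mathcomp Require Import all_boot all_order all_algebra.
From mathcomp Require Import complex.
From mathcomp Require Import all_classical all_reals all_analysis.

Set Implicit Arguments.
Unset Strict Implicit.
Unset Printing Implicit Defensive.

Import Order.TTheory GRing.Theory Num.Theory.
Import numFieldNormedType.Exports.

Local Open Scope classical_set_scope.
Local Open Scope ring_scope.
Local Open Scope complex_scope.

(* Complex scalars are R[i]; norms take their values in R[i], where [0 <= z]
   and [0 < z] imply that z is real. *)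

(* A C*-algebra need not have a unit, so its product is a field of the mixin
   and does not come from a MathComp ring structure. *)
HB.mixin Record CompleteNormedModule_isCStarAlgebra (R : realType) A
    of CompleteNormedModule R[i] A := {
  csmul : A -> A -> A;
  csstar : A -> A;
  csmulA : forall a b c, csmul a (csmul b c) = csmul (csmul a b) c;
  csmulDl : forall a b c, csmul (a + b) c = csmul a c + csmul b c;
  csmulDr : forall a b c, csmul a (b + c) = csmul a b + csmul a c;
  csmulZl : forall (k : R[i]) a b, csmul (k *: a) b = k *: csmul a b;
  csmulZr : forall (k : R[i]) a b, csmul a (k *: b) = k *: csmul a b;
  csmul_norm : forall a b, `|csmul a b| <= `|a| * `|b|;
  csstarK : forall a, csstar (csstar a) = a;
  csstarD : forall a b, csstar (a + b) = csstar a + csstar b;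
  csstarZ : forall (k : R[i]) a,
    csstar (k *: a) = (Num.conj k) *: csstar a;
  csstarM : forall a b, csstar (csmul a b) = csmul (csstar b) (csstar a);
  csstar_norm : forall a, `|csmul (csstar a) a| = `|a| ^+ 2
}.

#[short(type="cstarAlgType")]
HB.structure Definition CStarAlgebra (R : realType) :=
  {A of CompleteNormedModule_isCStarAlgebra R A & CompleteNormedModule R[i] A}.

(* Stated without the spectrum, which would require a unitization of A. *)
Definition cs_positive (R : realType) (A : cstarAlgType R) (a : A) : Prop :=
  exists b : A, a = csmul (csstar b) b.

(* Right Hilbert A-modules; the inner product is linear in its second
   argument.  Definiteness of the inner product is contained in [hinner_norm].
   The completeness of H is that of the norm `|x| = `|<x, x>| ^ (1/2). *)
HB.mixin Record CompleteNormedModule_isHilbertModule (R : realType)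
    (A : cstarAlgType R) H of CompleteNormedModule R[i] H := {
  hact : H -> A -> H;
  hinner : H -> H -> A;
  hactDl : forall x y a, hact (x + y) a = hact x a + hact y a;
  hactDr : forall x a b, hact x (a + b) = hact x a + hact x b;
  hactA : forall x a b, hact x (csmul a b) = hact (hact x a) b;
  hactZl : forall (k : R[i]) x a, hact (k *: x) a = k *: hact x a;
  hactZr : forall (k : R[i]) x a, hact x (k *: a) = k *: hact x a;
  hinnerDr : forall x y z, hinner x (y + z) = hinner x y + hinner x z;
  hinnerZr : forall (k : R[i]) x y, hinner x (k *: y) = k *: hinner x y;
  hinner_act : forall x y a, hinner x (hact y a) = csmul (hinner x y) a;
  hinner_star : forall x y, csstar (hinner x y) = hinner y x;
  hinner_pos : forall x, cs_positive (hinner x x);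
  hinner_norm : forall x, `|x| ^+ 2 = `|hinner x x|
}.

#[short(type="hilbertModType")]
HB.structure Definition HilbertModule (R : realType) (A : cstarAlgType R) :=
  {H of CompleteNormedModule_isHilbertModule R A H &
        CompleteNormedModule R[i] H}.

HB.mixin Record CompleteNormedModule_isHilbertSpace (R : realType) X
    of CompleteNormedModule R[i] X := {
  xinner : X -> X -> R[i];
  xinnerDr : forall x y z, xinner x (y + z) = xinner x y + xinner x z;
  xinnerZr : forall (k : R[i]) x y, xinner x (k *: y) = k * xinner x y;
  xinner_conj : forall x y, Num.conj (xinner x y) = xinner y x;
  xinner_norm : forall x, `|x| ^+ 2 = xinner x x
}.

#[short(type="hilbertType")]
HB.structure Definition HilbertSpace (R : realType) :=
  {X of CompleteNormedModule_isHilbertSpace R X & CompleteNormedModule R[i] X}.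

(* Notions depending only on a W-valued inner product [ip] on V; they are used
   both for Hilbert modules ([ip := hinner]) and for Hilbert spaces
   ([ip := xinner]). *)
Section InnerProduct.
Variables (V W : zmodType) (ip : V -> V -> W).

Definition adjoint_of (T S : V -> V) : Prop :=
  forall x y, ip (T x) y = ip x (S y).

Definition adjointable (T : V -> V) : Prop := exists S, adjoint_of T S.

Definition projection (P : V -> V) : Prop := adjoint_of P P /\ P \o P = P.

Definition orth (M : set V) : set V :=
  [set x | forall m, M m -> ip m x = 0].

Definition orth_complemented (M : set V) : Prop :=
  forall x, exists m n, [/\ M m, orth M n & x = m + n].

(* P_M, for M orthogonally complemented *)
Definition proj_onto (M : set V) : V -> V :=
  xget (0 : V -> V) [set P | projection P /\ range P = M].

Definition meet (P Q : V -> V) : V -> V := proj_onto (range Q `&` range P).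

End InnerProduct.

(* T lies in the closure of B for the operator norm: for every e > 0, some
   S in B satisfies ||T - S|| <= e. *)
Definition opnorm_closure (R : realType) (V : normedModType R[i])
    (B : set (V -> V)) : set (V -> V) :=
  [set T | forall e : R[i], 0 < e ->
    exists2 S, B S & forall x, `|T x - S x| <= e * `|x|].

Definition bounded_linear (R : realType) (V : normedModType R[i])
    (T : V -> V) : Prop :=
  linear T /\ exists M : R[i], forall x, `|T x| <= M * `|x|.

Section Operators.
Variables (R : realType) (A : cstarAlgType R) (H : hilbertModType A).

Let adj := adjoint_of (@hinner R A H).

(* C*-subalgebras of L(H), not required to contain the identity *)
Record cstar_subalgebra (B : set (H -> H)) : Prop := {
  csub_adjointable : forall T, B T -> adjointable (@hinner R A H) T;
  csub0 : B 0;
  csubD : forall T S, B T -> B S -> B (T + S);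
  csubZ : forall (k : R[i]) T, B T -> B (k *: T);
  csubM : forall T S, B T -> B S -> B (T \o S);
  csub_star : forall T S, B T -> adj T S -> B S;
  csub_closed : forall T, adjointable (@hinner R A H) T ->
    opnorm_closure B T -> B T
}.

Definition cstar_generated (G : set (H -> H)) : set (H -> H) :=
  smallest cstar_subalgebra G.

Definition matched (P Q : H -> H) : Prop :=
  [/\ projection (@hinner R A H) P, projection (@hinner R A H) Q &
      orth_complemented (@hinner R A H) (range Q `&` range P)].

Definition hmeet (P Q : H -> H) : H -> H := meet (@hinner R A H) P Q.

Definition inner_algebra (P Q : H -> H) : set (H -> H) :=
  cstar_generated [set P - hmeet P Q; Q - hmeet P Q; idfun].

Definition outer_algebra (P Q : H -> H) : set (H -> H) :=
  cstar_generated [set P; Q; hmeet P Q; idfun].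

(* A representation of B on X is carried by a total function on operators; its
   values outside B are irrelevant.  It need not send idfun to idfun. *)
Record representation (X : hilbertType R) (B : set (H -> H))
    (pi : (H -> H) -> (X -> X)) : Prop := {
  rep_bounded : forall T, B T -> bounded_linear (pi T);
  repD : forall T S, B T -> B S -> pi (T + S) = pi T + pi S;
  repZ : forall (k : R[i]) T, B T -> pi (k *: T) = k *: pi T;
  repM : forall T S, B T -> B S -> pi (T \o S) = pi T \o pi S;
  rep_star : forall T S, B T -> adj T S ->
    adjoint_of (@xinner R X) (pi T) (pi S)
}.

Definition faithful_representation (X : hilbertType R) (B : set (H -> H))
    (pi : (H -> H) -> (X -> X)) : Prop :=
  representation B pi /\ set_inj B pi.

End Operators.

Definition xmeet (R : realType) (X : hilbertType R) (P Q : X -> X) : X -> X :=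
  meet (@xinner R X) P Q.

(* Main.v *)
Require Import Defs.
From mathcomp Require Import all_boot all_order all_algebra.
From mathcomp Require Import complex.
From mathcomp Require Import all_classical all_reals all_analysis.
From mathcomp Require Import ring lra.

(** Write [E] for the meet of [P] and [Q], [P1 = P - E] and [Q1 = Q - E]; the
ranges of [P1] and [Q1] meet in [0].  On the side of [X] put [p = pi P],
[q = pi Q], [e = pi E], let [f] be the meet of [p] and [q] and [g = f - e].
Then [g] is the projection onto the common fixed vectors of [pi P1] and
[pi Q1], and it commutes with [pi T] for [T] in the inner algebra.  On the range
of [g] both [pi P1] and [pi Q1] act as the identity, whereas the required images
[p - f] and [q - f] act as [0] there; off the range of [g] nothing has to be
changed.  The new representation is therefore
   [pi' T = pi T (1 - g) + chi T *: g],
where [chi] is a character of the inner algebra which kills [P1] and [Q1] and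
sends the identity to [1].

Such a character exists as soon as [g <> 0] (for [g = 0] take [pi' = pi]).  It is
the quotient map of [N + C 1] by [N], the C*-algebra generated by [P1] and [Q1]
without the identity, so what has to be shown is that [N] does not contain the
identity.  Now [N] lies in the closure of the right ideal of the
[P1 a + Q1 b], and if the identity is in this closure then a Neumann series puts
it in the right ideal itself: [1 = P1 a + Q1 b].  A computation with idempotents
([no_common_fixed_vector]) then gives [Q1 = Q1 b (1 - P1) Q1], because the
difference of the two sides maps into the intersection of the ranges of [P1] and
[Q1].  Under [pi] the right-hand side kills every common fixed vector of [pi P1]
and [pi Q1], whence [g = 0].

Faithfulness is algebraic as well: if [pi' T = 0], then [pi T = g (pi T)], so
[pi (P1 T) = pi T = pi (Q1 T)]; since [pi] is injective, [T] maps into the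
intersection of the ranges of [P1] and [Q1], hence [T = 0].

Apart from the Neumann series the analytic input is twofold.  That [pi T]
commutes with [g] on the whole closed inner algebra requires [pi] to be continuous
([rep_continuous]), and the meet of two projections of [X] exists by the projection
theorem ([closed_subspace_complemented]).  Adjoints and projections of a Hilbert
module are bounded by real polarization ([opbound_adjoint_range]), with a constant
2 that is harmless everywhere. *)

Set Implicit Arguments.
Unset Strict Implicit.
Unset Printing Implicit Defensive.

Import Order.TTheory GRing.Theory Num.Theory.
Import numFieldNormedType.Exports.

Local Open Scope classical_set_scope.
Local Open Scope ring_scope.

(** * Real-valued norms and geometric Cauchy sequences *)

(** The explicit rate passes to the limit, so that no limit has to be taken
again after this lemma. *)
Lemma cauchy_rate (K : numFieldType) (V : completeNormedModType K)
    (u : nat -> V) (r : nat -> K) :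
  (forall n m, (n <= m)%N -> `|u m - u n| <= r n) ->
  (forall e, 0 < e -> exists n, r n < e) ->
  exists l, forall n, `|l - u n| <= r n.
Proof.
move=> ur r0.
have : cvg (u @ \oo).
  apply/cauchy_cvgP/cauchy_exP => e /r0[n rn]; exists (u n).
  exists n => // m /= nm; rewrite -ball_normE /ball_ /= distrC.
  exact: le_lt_trans (ur _ _ nm) rn.
move=> /cvg_ex[l ul]; exists l => n.
have ge0 : 0 <= r n by apply: le_trans (ur n n (leqnn _)).
rewrite -subr_ge0 real_leNgt ?rpredB ?ger0_real// .
apply/negP => lt0.
have e0 : 0 < `|l - u n| - r n by rewrite -opprB oppr_gt0.
move/cvgrPdist_lt : ul => /(_ _ e0)[N _ Nl].
have := Nl (maxn n N) (leq_maxr _ _); rewrite /= ltrBrDr.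
have h := ur _ _ (leq_maxl n N).
rewrite real_ltNge ?rpredD ?realE ?normr_ge0 ?ge0// => /negP; apply.
apply: le_trans (lerD (lexx _) h).
by rewrite -[X in `|X| <= _](subrKA (u (maxn n N))) ler_normD.
Qed.

Section RealNorm.
Variable R : realType.

(** Norms over complex scalars take their values in [R[i]]; the real-valued
copy makes them accessible to real arithmetic. *)
Definition rnorm (V : normedModType R[i]) (x : V) : R := complex.Re `|x|.

Lemma rnormE (V : normedModType R[i]) (x : V) : `|x| = (rnorm x)%:C%C.
Proof. by rewrite RRe_real// ger0_real. Qed.

Section Theory.
Variable V : normedModType R[i].
Implicit Types x y : V.

Lemma rnorm_ge0 x : 0 <= rnorm x.
Proof. by rewrite -ler0c -rnormE. Qed.

Lemma rnorm0 : rnorm (0 : V) = 0.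
Proof. by rewrite /rnorm normr0. Qed.

Lemma rnorm0_eq0 x : rnorm x <= 0 -> x = 0.
Proof. by move=> x0; apply/eqP; rewrite -normr_le0 rnormE lecR. Qed.

Lemma rnormD x y : rnorm (x + y) <= rnorm x + rnorm y.
Proof. by rewrite -lecR [leRHS]rmorphD/= -!rnormE ler_normD. Qed.

Lemma rnormN x : rnorm (- x) = rnorm x.
Proof. by rewrite /rnorm normrN. Qed.

Lemma rnormB x y : rnorm (x - y) <= rnorm x + rnorm y.
Proof. by rewrite -[in leRHS](rnormN y) rnormD. Qed.

Lemma rnormC x y : rnorm (x - y) = rnorm (y - x).
Proof. by rewrite /rnorm distrC. Qed.

Lemma rnormBD z x y : rnorm (x - y) <= rnorm (x - z) + rnorm (z - y).
Proof. by rewrite -[x - y](subrKA z) rnormD. Qed.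

Lemma rnormZ (k : R[i]) x : rnorm (k *: x) = Normc.normc k * rnorm x.
Proof.
by apply: (@complexI R); rewrite rmorphM/= -!rnormE normrZ.
Qed.

Lemma rnormZr (k : R) x : rnorm (k%:C%C *: x) = `|k| * rnorm x.
Proof. by rewrite rnormZ /= expr0n addr0 sqrtr_sqr. Qed.

End Theory.

Lemma geo_small (c e : R) : 0 < e -> exists n, c / 2 ^+ n < e.
Proof.
move=> e0; have : (fun n => c * 2^-1 ^+ n) @ \oo --> (0 : R).
  rewrite -[X in _ --> X](mulr0 c); apply: cvgMr; apply: cvg_expr.
  by rewrite ger0_norm ?invr_ge0//; lra.
move/cvgrPdist_lt => /(_ _ e0)[N _ /(_ N (leqnn _))].
rewrite sub0r normrN exprVn => h; exists N; exact: le_lt_trans (ler_norm _) h.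
Qed.

Lemma geo_le0 (a c : R) : (forall n, a <= c / 2 ^+ n) -> a <= 0.
Proof.
move=> ac; rewrite leNgt; apply/negP => /(geo_small c)[n].
by rewrite ltNge ac.
Qed.

Lemma normc_pos (k : R[i]) : 0 <= Normc.normc k.
Proof. by rewrite -lecR; exact: (normr_ge0 k). Qed.

Lemma geo_cauchy (V : completeNormedModType R[i]) (c : R) (u : nat -> V) :
  (forall n m, (n <= m)%N -> rnorm (u m - u n) <= c / 2 ^+ n) ->
  exists l, forall n, rnorm (l - u n) <= c / 2 ^+ n.
Proof.
move=> uc.
have [||l lu] := @cauchy_rate _ V u (fun n => (c / 2 ^+ n)%:C%C).
- by move=> n m nm; rewrite rnormE lecR uc.
- move=> e e0; have eE : (complex.Re e)%:C%C = e by rewrite RRe_real ?gtr0_real.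
  have [|n cn] := @geo_small c (complex.Re e).
    by rewrite -ltcR eE.
  by exists n; rewrite -eE ltcR.
- by exists l => n; rewrite -lecR -rnormE.
Qed.

Lemma normr_Re_le (z : R[i]) : `|complex.Re z| <= Normc.normc z.
Proof. by rewrite -lecR [leRHS]/(`|z|) normc_ge_Re. Qed.

Lemma normr_Im_le (z : R[i]) : `|complex.Im z| <= Normc.normc z.
Proof.
have := normr_Re_le (z * 'i%C); rewrite ReiNIm normrN Normc.normcM.
by rewrite [Normc.normc 'i%C]/= expr0n add0r expr1n sqrtr1 mulr1.
Qed.

(** Real and imaginary parts converge separately, which costs the factor 2. *)
Lemma geo_cauchy_complex (c : R) (u : nat -> R[i]) :
  (forall n m, (n <= m)%N -> Normc.normc (u m - u n) <= c / 2 ^+ n) ->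
  exists l, forall n, Normc.normc (l - u n) <= 2 * c / 2 ^+ n.
Proof.
move=> uc.
have lim (f : {additive R[i] -> R}) : (forall z, `|f z| <= Normc.normc z) ->
    exists l, forall n, `|l - f (u n)| <= c / 2 ^+ n.
  move=> fle; apply: (@cauchy_rate _ R) => [n m nm|e]; last exact: geo_small.
  by rewrite -raddfB; apply: le_trans (fle _) (uc _ _ nm).
have [a ua] := lim _ normr_Re_le; have [b ub] := lim _ normr_Im_le.
exists (Complex a b) => n.
have -> : Complex a b - u n =
    (a - complex.Re (u n))%:C%C + 'i%C * (b - complex.Im (u n))%:C%C.
  by case: (u n) => x y /=; simpc.
apply: le_trans (le_normcD _ _) _; rewrite Normc.normcM /=.
rewrite expr0n expr1n /= add0r !addr0 sqrtr1 !sqrtr_sqr mul1r.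
by have := ua n; have := ub n; lra.
Qed.

End RealNorm.

(** * Inner products, adjoints and projections *)

(** What Hilbert modules and Hilbert spaces have in common, with [star] the
involution of the algebra or complex conjugation.  Only the additive structure
is recorded: it determines adjoints and orthogonal projections. *)
Record inner_product (V W : zmodType) (ip : V -> V -> W) (star : W -> W) :
    Prop := {
  ipDr : forall x y z, ip x (y + z) = ip x y + ip x z;
  ip_star : forall x y, star (ip x y) = ip y x;
  ip_starD : forall a b, star (a + b) = star a + star b;
  ip_def : forall x, ip x x = 0 -> x = 0
}.

Section InnerProductTheory.
Variables (V W : zmodType) (ip : V -> V -> W) (star : W -> W).
Hypothesis ipP : inner_product ip star.

Lemma ip0r x : ip x 0 = 0.
Proof. by apply: (@addrI _ (ip x 0)); rewrite -(ipDr ipP) !addr0. Qed.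

Lemma ipBr x y z : ip x (y - z) = ip x y - ip x z.
Proof. by apply: (@addIr _ (ip x z)); rewrite -(ipDr ipP) !subrK. Qed.

Lemma ipDl x y z : ip (x + y) z = ip x z + ip y z.
Proof. by rewrite -(ip_star ipP) (ipDr ipP) (ip_starD ipP) !(ip_star ipP). Qed.

Lemma ip0l x : ip 0 x = 0.
Proof. by apply: (@addrI _ (ip 0 x)); rewrite -ipDl !addr0. Qed.

Lemma ipBl x y z : ip (x - y) z = ip x z - ip y z.
Proof. by apply: (@addIr _ (ip y z)); rewrite -ipDl !subrK. Qed.

Lemma ip_sym0 x y : ip x y = 0 -> ip y x = 0.
Proof.
move=> xy; have star0 : star 0 = 0 by rewrite -(ip0r 0) (ip_star ipP).
by rewrite -(ip_star ipP) xy star0.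
Qed.

Lemma ip_extr x y : (forall z, ip z x = ip z y) -> x = y.
Proof.
move=> xy; apply/eqP; rewrite -subr_eq0; apply/eqP/(ip_def ipP).
by rewrite ipBr xy subrr.
Qed.

Lemma adjointC T S : adjoint_of ip T S -> adjoint_of ip S T.
Proof. by move=> TS x y; rewrite -(ip_star ipP) -TS (ip_star ipP). Qed.

Lemma adjoint_uniq T S S' : adjoint_of ip T S -> adjoint_of ip T S' -> S = S'.
Proof.
by move=> TS TS'; apply/funext => x; apply: ip_extr => z; rewrite -TS -TS'.
Qed.

Lemma adjointableD T x y : adjointable ip T -> T (x + y) = T x + T y.
Proof.
move=> [S /adjointC ST]; apply: ip_extr => z.
by rewrite (ipDr ipP) -!ST (ipDr ipP).
Qed.

Lemma adjointableB T x y : adjointable ip T -> T (x - y) = T x - T y.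
Proof.
by move=> hT; apply: (@addIr _ (T y)); rewrite -adjointableD// !subrK.
Qed.

Lemma adjointable0 T : adjointable ip T -> T 0 = 0.
Proof. by move=> hT; have := adjointableB 0 0 hT; rewrite !subrr. Qed.

Lemma adjoint0 : adjoint_of ip 0 0.
Proof. by move=> x y; rewrite ip0l ip0r. Qed.

Lemma adjointD T T' S S' : adjoint_of ip T T' -> adjoint_of ip S S' ->
  adjoint_of ip (T + S) (T' + S').
Proof. by move=> TT SS x y; rewrite ipDl (ipDr ipP) TT SS. Qed.

Lemma adjointB T T' S S' : adjoint_of ip T T' -> adjoint_of ip S S' ->
  adjoint_of ip (T - S) (T' - S').
Proof. by move=> TT SS x y; rewrite ipBl ipBr TT SS. Qed.

Lemma adjointM T T' S S' : adjoint_of ip T T' -> adjoint_of ip S S' ->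
  adjoint_of ip (T \o S) (S' \o T').
Proof. by move=> TT SS x y; rewrite /= TT SS. Qed.

(** Take adjoints in [T S = S]. *)
Lemma selfadjoint_absorbC T S : adjoint_of ip T T -> adjoint_of ip S S ->
  T \o S = S -> S \o T = S.
Proof.
move=> TT SS TS; apply/funext => x; apply: ip_extr => z /=.
by rewrite -SS -TT -[T (S z)]/((T \o S) z) TS SS.
Qed.

Lemma proj_rangeP P x : projection ip P -> range P x <-> P x = x.
Proof.
move=> [_ PP]; split=> [[y _ <-]|Px]; last by exists x.
by rewrite -[LHS]/((P \o P) y) PP.
Qed.

(** The component in [M] of each vector, picked by choice, is a self-adjoint
map because the other component is orthogonal to [M], and definiteness makes it
the identity on [M]. *)
Lemma proj_ontoP M : orth_complemented ip M ->
  projection ip (proj_onto ip M) /\ range (proj_onto ip M) = M.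
Proof.
move=> /choice[P hP].
apply: (@xgetPex _ 0 [set P | projection ip P /\ range P = M]); exists P => /=.
have PM x : M (P x) by have [n []] := hP x.
have xP m x : M m -> ip m (x - P x) = 0.
  by have [n [_ nM xE]] := hP x; rewrite [X in X - _]xE addrC addKr; exact: nM.
have adjP : adjoint_of ip P P.
  move=> x y; transitivity (ip (P x) (P y)).
    by apply/eqP; rewrite -subr_eq0 -ipBr xP.
  by apply/esym/eqP; rewrite -subr_eq0 -ipBl; apply/eqP/ip_sym0/xP.
have PE x : M x -> P x = x.
  move=> Mx; apply/esym/eqP; rewrite -subr_eq0; apply/eqP/(ip_def ipP).
  by rewrite ipBl !xP// subrr.
split; first by split=> //; apply/funext => x; rewrite /= PE.
by apply/seteqP; split=> [_ [x _ <-]//|x Mx]; exists x => //; exact: PE.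
Qed.

Lemma meet_absorbs P Q (E := meet ip P Q) :
    projection ip P -> projection ip Q ->
    orth_complemented ip (range Q `&` range P) ->
  [/\ projection ip E, P \o E = E, Q \o E = E, E \o P = E & E \o Q = E].
Proof.
move=> hP hQ /proj_ontoP[hE rE].
have EM x : (range Q `&` range P) (E x) by rewrite -rE; exists x.
have PE : P \o E = E.
  by apply/funext => x /=; apply/(proj_rangeP _ hP); case: (EM x).
have QE : Q \o E = E.
  by apply/funext => x /=; apply/(proj_rangeP _ hQ); case: (EM x).
by split=> //; apply: selfadjoint_absorbC => //; [case: hP|case: hE|case: hQ|case: hE].
Qed.

Lemma meet_id P Q x : projection ip P -> projection ip Q ->
    orth_complemented ip (range Q `&` range P) ->
  P x = x -> Q x = x -> meet ip P Q x = x.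
Proof.
move=> hP hQ /proj_ontoP[hE rE] Px Qx.
have : (range Q `&` range P) x by split; apply/proj_rangeP.
by rewrite -rE => /(proj_rangeP _ hE).
Qed.

Lemma projection_sub P E : projection ip P -> projection ip E ->
  P \o E = E -> projection ip (P - E).
Proof.
move=> hP hE PE; have EP : E \o P = E.
  by apply: selfadjoint_absorbC => //; [case: hP|case: hE].
case: hP hE => adjP PP [adjE EE]; split.
  by move=> x y; rewrite !fctE ipBl ipBr adjP adjE.
apply/funext => x /=; rewrite !fctE.
rewrite (@adjointableB P); last by exists P.
rewrite (@adjointableB E); last by exists E.
rewrite -[P (P x)]/((P \o P) x) -[P (E x)]/((P \o E) x) PP PE.
by rewrite -[E (P x)]/((E \o P) x) -[E (E x)]/((E \o E) x) EP EE subrr subr0.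
Qed.

End InnerProductTheory.

(** * Operator bounds *)

Definition opbound (R : realType) (V : normedModType R[i]) (c : R) (T : V -> V) :=
  forall x, rnorm (T x) <= c * rnorm x.

Section OpBound.
Variables (R : realType) (V : normedModType R[i]).
Implicit Types (T S : V -> V) (c d : R).

Lemma opboundW c d T : c <= d -> opbound c T -> opbound d T.
Proof. by move=> cd Tc x; apply: le_trans (Tc x) _; rewrite ler_wpM2r ?rnorm_ge0. Qed.

Lemma opboundD c d T S : opbound c T -> opbound d S -> opbound (c + d) (T + S).
Proof.
move=> Tc Sd x; apply: le_trans (rnormD _ _) _.
by rewrite mulrDl lerD.
Qed.

Lemma opboundN c T : opbound c T -> opbound c (- T).
Proof. by move=> Tc x; rewrite fctE rnormN. Qed.

Lemma opboundZ c T (k : R[i]) : opbound c T -> opbound (Normc.normc k * c) (k *: T).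
Proof.
by move=> Tc x; rewrite fctE rnormZ -mulrA ler_wpM2l ?normc_pos.
Qed.

Lemma opbound_comp c d T S : 0 <= c -> opbound c T -> opbound d S ->
  opbound (c * d) (T \o S).
Proof.
move=> c0 Tc Sd x; apply: le_trans (Tc _) _.
by rewrite -mulrA ler_wpM2l.
Qed.

Lemma opbound0 : opbound 0 (0 : V -> V).
Proof. by move=> x; rewrite [X in rnorm X](_ : _ = 0)// rnorm0 mul0r. Qed.

(** The constant [M] need not be real when the module is trivial. *)
Lemma opbound_real (T : V -> V) (M : R[i]) : (forall x : V, `|T x| <= M * `|x|) ->
  exists2 c, 0 < c & opbound c T.
Proof.
move=> TM; exists (Normc.normc M + 1).
  by rewrite ltr_wpDl ?normc_pos.
move=> x; have : rnorm (T x) <= Normc.normc M * rnorm x.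
  rewrite -lecR rmorphM/= -!rnormE -[(Normc.normc M)%:C%C]/`|M|.
  have := le_trans (normr_ge0 _) (TM x) => /ger0_norm h.
  by rewrite -[X in _ * X]normr_id -normrM h.
by move/le_trans; apply; rewrite mulrDl mul1r lerDl rnorm_ge0.
Qed.

Lemma opnorm_closureP (B : set (V -> V)) T : opnorm_closure B T <->
  forall e : R, 0 < e -> exists2 S, B S & opbound e (T - S).
Proof.
split=> [cl e e0|cl e e0].
  have [|S BS TS] := cl e%:C%C; first by rewrite ltcR.
  by exists S => // x; rewrite -lecR rmorphM/= -!rnormE; exact: TS.
have eE : (complex.Re e)%:C%C = e by rewrite RRe_real ?gtr0_real.
have [|S BS TS] := cl (complex.Re e); first by rewrite -ltcR eE.
exists S => // x; rewrite -eE !rnormE.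
rewrite -[(_ * _)%R](rmorphM (real_complex R)) lecR; exact: TS.
Qed.

Lemma opnorm_closure_sub (B : set (V -> V)) : B `<=` opnorm_closure B.
Proof.
move=> T BT; apply/opnorm_closureP => e e0; exists T => // x.
by rewrite subrr rnorm0 mulr_ge0 ?rnorm_ge0 ?ltW.
Qed.

End OpBound.

(** * Adjointable operators on a Hilbert module *)

Section HilbertModules.
Variables (R : realType) (A : cstarAlgType R) (H : hilbertModType A).
Implicit Types (x y z : H) (T S : H -> H) (B D : set (H -> H)).

Local Notation ip := (@hinner R A H).
Local Notation adj := (adjoint_of (@hinner R A H)).

Lemma hinnerP : inner_product ip (@csstar R A).
Proof.
split; [exact: hinnerDr|exact: hinner_star|exact: csstarD|move=> x x0].
have := hinner_norm x; rewrite [hinner x x]x0 normr0 => /eqP.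
by rewrite sqrf_eq0 normr_eq0 => /eqP.
Qed.

Lemma rnorm_hinner x : rnorm (ip x x) = rnorm x ^+ 2.
Proof. by apply: (@complexI R); rewrite rmorphXn/= -!rnormE hinner_norm. Qed.

Lemma adjointableZ T (k : R[i]) x : adjointable ip T -> T (k *: x) = k *: T x.
Proof.
move=> [S /(adjointC hinnerP) ST]; apply: (ip_extr hinnerP) => z.
by rewrite -ST !hinnerZr -ST.
Qed.

(** For [y = t T (S x)] the products <x, y> and <y, x> are both equal to
[t <S x, S x>], so 4 t |S x|^2 is the norm of <x + y, x + y> - <x - y, x - y>
and is at most 2 (|x| + |y|)^2; then optimize over [t].  A bound on the
range of [S] suffices, which makes the lemma apply to a projection [T = S], whose
boundedness is not known beforehand. *)
Lemma opbound_adjoint_range T S (c : R) : 0 < c -> adj T S ->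
  (forall x, rnorm (T (S x)) <= c * rnorm (S x)) -> opbound (2 * c) S.
Proof.
move=> c0 TS Tc x.
pose a := rnorm (S x); pose b := rnorm x; rewrite -/a -/b.
have a0 : 0 <= a := rnorm_ge0 _.
have b0 : 0 <= b := rnorm_ge0 _.
(* For a, b, c > 0 the inequality [key] is used at t = b / (c a). *)
suff key (t : R) : 0 <= t -> 2 * (t * a ^+ 2) <= (b + t * (c * a)) ^+ 2.
  have [a_eq0|/eqP an0] := eqVneq a 0; first by rewrite a_eq0 !mulr_ge0// ltW.
  have ap : 0 < a by rewrite lt_def a0 andbT; apply/eqP.
  have h : 2 * (b / (c * a) * a ^+ 2) <= (b + b / (c * a) * (c * a)) ^+ 2.
    by apply: key; rewrite divr_ge0// mulr_ge0// ltW.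
  have cN : c != 0 by rewrite gt_eqF.
  have aN : a != 0 by rewrite gt_eqF.
  have [b_eq0|/eqP bn0] := eqVneq b 0.
    (* For b = 0 and t = c^-2 the factor 2 on the left is contradictory. *)
    have := key (c ^- 2) _; rewrite b_eq0 add0r invr_ge0 sqr_ge0 => /(_ isT).
    have -> : (c ^- 2 * (c * a)) ^+ 2 = c ^- 2 * a ^+ 2 by field.
    have : 0 < c ^- 2 * a ^+ 2 by rewrite mulr_gt0 ?invr_gt0 ?exprn_gt0.
    by lra.
  have bp : 0 < b by rewrite lt_def b0 andbT; apply/eqP.
  move: h; rewrite (_ : 2 * _ = 2 * (b * a / c)); last by field; apply/andP.
  rewrite (_ : (b + _) ^+ 2 = 4 * b ^+ 2); last by field; apply/andP.
  move=> h; have {}h : b * a / c <= b * (2 * b) by nra.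
  move: h; rewrite ler_pdivrMr// -!mulrA ler_pM2l// => h'.
  by rewrite [c * b]mulrC.
move=> t0; pose y := t%:C%C *: T (S x).
have xy : ip x y = t%:C%C *: ip (S x) (S x).
  by rewrite /y hinnerZr -(adjointC hinnerP TS).
have yx : ip y x = t%:C%C *: ip (S x) (S x).
  by rewrite -[LHS]hinner_star xy csstarZ hinner_star conj_Creal// complex_real.
have pol : ip (x + y) (x + y) - ip (x - y) (x - y) =
    (4 * t)%:C%C *: ip (S x) (S x).
  rewrite (ipBl hinnerP) !(ipBr hinnerP) (ipDl hinnerP) !(ipDr hinnerP) xy yx.
  rewrite [(4 * t)%R](_ : _ = t + t + (t + t)); last by lra.
  rewrite !rmorphD/= !scalerDl; set v := _ *: _; set z := ip x x; set w := ip y y.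
  rewrite (opprB (z - v) (v - w)) (opprB z v) [v - w + _]addrC addrACA.
  by rewrite [z + v]addrC (addrACA v z v) (addrACA v w v) !subrr !addr0.
have y_le : rnorm y <= t * (c * a).
  by rewrite rnormZr ger0_norm// ler_wpM2l// Tc.
have := rnormB (ip (x + y) (x + y)) (ip (x - y) (x - y)).
rewrite pol rnormZr !rnorm_hinner ger0_norm; last by lra.
have sq (u : H) : rnorm u <= b + rnorm y -> rnorm u ^+ 2 <= (b + t * (c * a)) ^+ 2.
  move=> hu; rewrite ler_sqr ?nnegrE ?rnorm_ge0 ?addr_ge0 ?mulr_ge0 ?(ltW c0)//.
  by apply: le_trans hu _; rewrite lerD2l.
have := sq _ (rnormD x y); have := sq _ (rnormB x y).
by rewrite -/a; lra.
Qed.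

Lemma opbound_adjoint T S (c : R) : 0 < c -> adj T S -> opbound c T ->
  opbound (2 * c) S.
Proof. by move=> c0 TS Tc; apply: opbound_adjoint_range c0 TS _ => x. Qed.

Lemma opbound_projection T : projection ip T -> opbound 2 T.
Proof.
move=> [TT T2]; rewrite -[2]mulr1; apply: opbound_adjoint_range TT _ => // x.
by rewrite mul1r -[T (T x)]/((T \o T) x) T2.
Qed.

End HilbertModules.

(** * C*-subalgebras *)

Section Subalgebras.
Variables (R : realType) (A : cstarAlgType R) (H : hilbertModType A).
Implicit Types (x y z : H) (T S : H -> H) (B D G : set (H -> H)).

Local Notation ip := (@hinner R A H).
Local Notation adj := (adjoint_of (@hinner R A H)).
Local Notation ipH := (@hinnerP R A H).

Lemma adjointZ (k : R[i]) T S : adj T S -> adj (k *: T) (Num.conj k *: S).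
Proof.
by move=> TS x y; rewrite hinnerZr -TS -[LHS]hinner_star hinnerZr csstarZ hinner_star.
Qed.

(** Boundedness is what lets norm approximations be composed with operators.
It passes to adjoints and to norm limits, so a C*-algebra generated by bounded
operators, such as projections, consists of bounded operators. *)
Definition bounded_adjointable : set (H -> H) :=
  [set T | adjointable ip T /\ exists2 c, 0 < c & opbound c T].

Lemma bounded_adjointable_subalgebra : cstar_subalgebra bounded_adjointable.
Proof.
split.
- by move=> T [].
- split; first by exists 0; exact: (adjoint0 ipH).
  by exists 1 => //; apply: opboundW (@opbound0 _ _).
- move=> T S [[T' TT] [c c0 Tc]] [[S' SS] [d d0 Sd]]; split.
    by exists (T' + S'); exact: (adjointD ipH).
  by exists (c + d); [rewrite addr_gt0|exact: opboundD].
- move=> k T [[T' TT] [c c0 Tc]]; split.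
    by exists (Num.conj k *: T'); exact: adjointZ.
  exists (Normc.normc k * c + 1); first by rewrite ltr_wpDl// mulr_ge0 ?normc_pos// ltW.
  by apply: opboundW (opboundZ _ Tc); rewrite lerDl.
- move=> T S [[T' TT] [c c0 Tc]] [[S' SS] [d d0 Sd]]; split.
    by exists (S' \o T'); exact: adjointM.
  by exists (c * d); [rewrite mulr_gt0|exact: opbound_comp (ltW c0) _ _].
- move=> T S [[T' TT] [c c0 Tc]] TS; split.
    by exists T; exact: (adjointC ipH).
  by exists (2 * c); [rewrite mulr_gt0|exact: opbound_adjoint Tc].
- move=> T hT /opnorm_closureP/(_ 1 ltr01)[S [_ [c c0 Sc]] TS]; split=> //.
  exists (1 + c); first by rewrite addr_gt0.
  by rewrite -(subrK S T); exact: opboundD.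
Qed.

Lemma cstar_generated_subalgebra G : G `<=` bounded_adjointable ->
  cstar_subalgebra (cstar_generated G).
Proof.
move=> Gb; split.
- move=> T /(_ _ (conj bounded_adjointable_subalgebra Gb)).
  exact: csub_adjointable bounded_adjointable_subalgebra _.
- by move=> B [hB _]; exact: csub0.
- by move=> T S GT GS B hB; apply: (csubD hB.1); [exact: GT|exact: GS].
- by move=> k T GT B hB; apply: (csubZ hB.1); exact: GT.
- by move=> T S GT GS B hB; apply: (csubM hB.1); [exact: GT|exact: GS].
- by move=> T S GT TS B hB; apply: (csub_star hB.1 _ TS); exact: GT.
- move=> T hT cl B hB; apply: (csub_closed hB.1) => // e e0.
  by have [S GS TS] := cl e e0; exists S => //; exact: GS.
Qed.

Lemma cstar_generated_bounded G : G `<=` bounded_adjointable ->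
  cstar_generated G `<=` bounded_adjointable.
Proof. exact: smallest_sub bounded_adjointable_subalgebra. Qed.

Section Closure.
Variable D : set (H -> H).
Hypothesis hD : cstar_subalgebra D.

Lemma csubN T : D T -> D (- T).
Proof. by move=> DT; rewrite -scaleN1r; exact: csubZ. Qed.

Lemma csubB T S : D T -> D S -> D (T - S).
Proof. by move=> DT DS; apply: csubD => //; exact: csubN. Qed.

Lemma csub_has_adjoint T : D T -> exists2 S, D S & adj T S.
Proof.
by move=> DT; have [S TS] := csub_adjointable hD DT; exists S => //; exact: csub_star TS.
Qed.

End Closure.

(** ** Neumann series *)

(** The fixed point of [z |-> x + W z], as the limit of its iterates. *)
Lemma neumann_solution W : adjointable ip W -> opbound (2^-1) W ->
  exists J : H -> H, forall x, J x = x + W (J x) /\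
    forall n, rnorm (J x - iter n (fun z => x + W z) 0) <= 2 * rnorm x / 2 ^+ n.
Proof.
move=> hW Wb.
suff sol x : exists l, l = x + W l /\
    forall n, rnorm (l - iter n (fun z => x + W z) 0) <= 2 * rnorm x / 2 ^+ n.
  by have [J JP] := choice sol; exists J.
pose y n := iter n (fun z => x + W z) 0.
have yS n m : rnorm (y m.+1 - y n.+1) <= 2^-1 * rnorm (y m - y n).
  by rewrite /= opprD addrACA subrr add0r -(adjointableB ipH)//.
have y_le n : rnorm (y n) <= 2 * rnorm x.
  elim: n => [|n IHn]; first by rewrite /= rnorm0 mulr_ge0 ?rnorm_ge0.
  by apply: le_trans (rnormD _ _) _; have := Wb (y n); lra.
have y_cauchy n m : (n <= m)%N -> rnorm (y m - y n) <= 2 * rnorm x / 2 ^+ n.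
  elim: n m => [|n IHn] [|m]; rewrite ?expr0 ?divr1 //.
  - by rewrite subrr rnorm0 mulr_ge0 ?rnorm_ge0.
  - by rewrite subr0.
  rewrite ltnS => /IHn h; apply: le_trans (yS _ _) _.
  by rewrite exprS invfM [leRHS]mulrCA ler_wpM2l.
have [l yl] := geo_cauchy y_cauchy; exists l; split=> //.
apply/eqP; rewrite -subr_eq0; apply/eqP/rnorm0_eq0/(@geo_le0 _ _ (2 * rnorm x)).
move=> n; apply: le_trans (rnormBD (y n.+1) _ _) _.
have -> : y n.+1 - (x + W l) = W (y n - l).
  by rewrite (adjointableB ipH)// /= opprD addrACA subrr add0r.
have := Wb (y n - l); rewrite (rnormC (y n)); have := yl n; have := yl n.+1.
rewrite exprS invfM; move: (_ ^- n) => u; lra.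
Qed.

(** The bound [1/4] on [W] makes the adjoint of [W] bounded by [1/2], so the
Neumann series of both converge; they give an adjoint of [J]. *)
Lemma neumann_inverse D W : cstar_subalgebra D -> D idfun -> D W ->
    opbound (4^-1) W ->
  exists2 J, D J & (idfun - W) \o J = idfun /\ J \o (idfun - W) = idfun.
Proof.
move=> hD D1 DW Wb.
have [W' DW' WW'] := csub_has_adjoint hD DW.
have aW : adjointable ip W by exists W'.
have aW' : adjointable ip W' by exists W; exact: (adjointC ipH).
have Wb2 : opbound (2^-1) W by apply: opboundW Wb; lra.
have Wb' : opbound (2^-1) W'.
  by apply: opboundW (opbound_adjoint _ WW' Wb); lra.
have [J hJ] := neumann_solution aW Wb2.
have [J' hJ'] := neumann_solution aW' Wb'.
have JE x : J x - W (J x) = x by rewrite {1}(hJ x).1 addrK.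
have J'E x : J' x - W' (J' x) = x by rewrite {1}(hJ' x).1 addrK.
have aJ : adjointable ip J.
  exists J' => x z; rewrite -{1}(J'E z) (ipBr ipH) -WW' -(ipBl ipH).
  by rewrite JE.
exists J.
  apply: (csub_closed hD) => //; apply/opnorm_closureP => e /(geo_small 2)[n n2].
  pose Y n : H -> H := iter n (fun S => idfun + (W \o S)) 0.
  have DY m : D (Y m).
    elim: m => [|m IHm]; first exact: csub0.
    by apply: (csubD hD) => //; exact: csubM.
  exists (Y n) => // x; have YE m : Y m x = iter m (fun z => x + W z) 0.
    by elim: m => //= m <-.
  rewrite !fctE YE; apply: le_trans ((hJ x).2 n) _.
  by rewrite mulrAC ler_wpM2r ?rnorm_ge0// ltW.
split; apply/funext => x /=; rewrite !fctE /=; first exact: JE.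
pose z := J (x - W x) - x; suff z0 : z = 0 by apply/eqP; rewrite -subr_eq0 -/z z0.
have zE : z = W z.
  apply/eqP; rewrite -subr_eq0 /z (adjointableB ipH _ _ aW) opprD addrACA JE.
  by rewrite -opprD subrr.
by apply: rnorm0_eq0; have := Wb2 z; rewrite -zE; lra.
Qed.

(** ** Adjoining the unit *)

Section ScalarPart.
Variable D : set (H -> H).
Hypothesis hD : cstar_subalgebra D.

(** [T] lies in [k + D].  The complex number [k] is unique when [D] does not
contain the identity, and then depends on [T] as a character. *)
Definition scalar_part T (k : R[i]) : Prop := D (T - k *: idfun).

Lemma scalar_part0 T : D T -> scalar_part T 0.
Proof. by move=> DT; rewrite /scalar_part scale0r subr0. Qed.

Lemma scalar_part1 : scalar_part idfun 1.
Proof. by rewrite /scalar_part scale1r subrr; exact: csub0. Qed.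

Lemma scalar_part_adjointable T k : scalar_part T k -> adjointable ip T.
Proof.
move=> /(csub_adjointable hD)[S hS]; exists (S + Num.conj k *: idfun).
rewrite -(subrK (k *: idfun) T); apply: (adjointD ipH) => //.
by apply: adjointZ => x y.
Qed.

Lemma scalar_partD T S k l : scalar_part T k -> scalar_part S l ->
  scalar_part (T + S) (k + l).
Proof.
by move=> Tk Sl; rewrite /scalar_part scalerDl opprD addrACA; exact: csubD.
Qed.

Lemma scalar_partZ (k : R[i]) T l : scalar_part T l -> scalar_part (k *: T) (k * l).
Proof. by move=> Tl; rewrite /scalar_part -scalerA -scalerBr; exact: csubZ. Qed.

Lemma scalar_partM T S k l : scalar_part T k -> scalar_part S l ->
  scalar_part (T \o S) (k * l).
Proof.
move=> Tk Sl; have aT := scalar_part_adjointable Tk; rewrite /scalar_part.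
have -> : T \o S - (k * l) *: idfun = (T - k *: idfun) \o (S - l *: idfun) +
    (l *: (T - k *: idfun) + k *: (S - l *: idfun)).
  apply/funext => x; rewrite !fctE /=.
  rewrite (adjointableB ipH _ _ aT) (adjointableZ _ _ aT) /=.
  set u := k *: (S x - _); rewrite scalerBr scalerA mulrC.
  by rewrite [_ - _ + u]addrC addrA subrK subrKA.
by apply: (csubD hD); [exact: csubM|apply: (csubD hD); exact: csubZ].
Qed.

Lemma scalar_part_star T S k : scalar_part T k -> adj T S ->
  scalar_part S (Num.conj k).
Proof.
move=> Tk TS; apply: (csub_star hD Tk); apply: (adjointB ipH) => //.
by apply: adjointZ => x y.
Qed.

Hypothesis D1 : ~ D idfun.

Lemma scalar_part_uniq T k l : scalar_part T k -> scalar_part T l -> k = l.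
Proof.
move=> Tk Tl; apply: contra_notP D1 => /eqP; rewrite -subr_eq0 => kl.
rewrite -[idfun](scalerK kl); apply: (csubZ hD).
by have := csubB hD Tl Tk; rewrite opprB addrC subrKA -scalerBl.
Qed.

(** Closedness: if [d] is a lower bound for the distance of the identity to
[D], the scalar parts of [T] and [S] differ by at most |T - S| / d, so those of a
convergent sequence of operators converge. *)
Lemma unitization_subalgebra :
  cstar_subalgebra [set T | exists k, scalar_part T k].
Proof.
have adj1 (k : R[i]) : adj (k *: idfun) (Num.conj k *: idfun).
  by apply: adjointZ => x y.
(* d is a lower bound for the distance of the identity to D. *)
have [d d0 far] : exists2 d : R, 0 < d &
    forall S, D S -> forall c : R, opbound c (idfun - S) -> d < c.
  apply: contra_notP D1 => near; apply: (csub_closed hD); first by exists idfun.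
  apply/opnorm_closureP => e e0; apply: contra_notP near => far.
  exists e => // S DS c Sc; rewrite ltNge; apply/negP => ce; apply: far.
  by exists S => //; exact: opboundW Sc.
have close T S k l (c : R) : D (T - k *: idfun) -> D (S - l *: idfun) ->
    0 <= c -> opbound c (T - S) -> Normc.normc (k - l) <= c / d.
  move=> Tk Sl c0 TSc; have [->|kl] := eqVneq (k - l) 0.
    by rewrite Normc.normc0 divr_ge0 ?(ltW d0).
  (* (T - S) / (k - l) differs from the identity by an element of D. *)
  have E : idfun - - ((k - l)^-1 *: (T - k *: idfun - (S - l *: idfun))) =
      (k - l)^-1 *: (T - S) :> (H -> H).
    rewrite opprK -[X in X + _](scale1r (idfun : H -> H)) -(mulVf kl) -scalerA.
    rewrite -scalerDr scalerBl; congr (_ *: _).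
    by rewrite addrC opprB -addrA (addrC (_ - S)) !subrKA.
  have Dn : D (- ((k - l)^-1 *: (T - k *: idfun - (S - l *: idfun)))).
    by apply: (csubN hD); apply: (csubZ hD); exact: (csubB hD).
  have := far _ Dn (Normc.normc (k - l)^-1 * c).
  rewrite E => /(_ (opboundZ _ TSc)); rewrite Normc.normcV => h.
  rewrite ler_pdivlMr// mulrC -ler_pdivlMr; last first.
    by rewrite lt_def normc_pos andbT; apply: contra_neq kl => /Normc.eq0_normc.
  by rewrite mulrC ltW.
split.
- by move=> T [k]; exact: scalar_part_adjointable.
- by exists 0; apply: scalar_part0; exact: csub0.
- by move=> T S [k Tk] [l Sl]; exists (k + l); exact: scalar_partD.
- by move=> k T [l Tl]; exists (k * l); exact: scalar_partZ.
- by move=> T S [k Tk] [l Sl]; exists (k * l); exact: scalar_partM.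
- by move=> T S [k Tk] TS; exists (Num.conj k); exact: scalar_part_star TS.
move=> T hT /opnorm_closureP cl.
have [S hS] : exists S : nat -> H -> H, forall n,
    (exists k : R[i], D (S n - k *: idfun)) /\ opbound (d / 2 / 2 ^+ n) (T - S n).
  suff sol n : exists S, (exists k : R[i], D (S - k *: idfun)) /\
      opbound (d / 2 / 2 ^+ n) (T - S) by have [S SP] := choice sol; exists S.
  by have [|S ? ?] := cl (d / 2 / 2 ^+ n); [rewrite !divr_gt0|exists S].
have [k hk] := choice (fun n => (hS n).1).
have Sk n := (hS n).2.
have [l kl] : exists l, forall n, Normc.normc (l - k n) <= 2 * 1 / 2 ^+ n.
  apply: geo_cauchy_complex => n m nm.
  have : opbound (d / 2 ^+ n) (S m - S n).
    have := opboundD (opboundN (Sk m)) (Sk n).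
    rewrite opprB subrKA; apply: opboundW.
    have : d / 2 / 2 ^+ m <= d / 2 / 2 ^+ n.
      rewrite ler_wpM2l ?divr_ge0 ?(ltW d0)// lef_pV2 ?posrE ?exprn_gt0//.
      by rewrite ler_weXn2l// ler1n.
    by move=> h; rewrite [X in _ <= X / _](splitr d) mulrDl lerD2r.
  move/(close _ _ _ _ _ (hk m) (hk n)).
  rewrite divr_ge0 ?(ltW d0) ?exprn_ge0// => /(_ isT)/le_trans; apply.
  by rewrite mulrAC divff ?gt_eqF.
exists l; apply: (csub_closed hD).
  have [T' TT] := hT; exists (T' - Num.conj l *: idfun); exact: (adjointB ipH).
apply/opnorm_closureP => e e0.
have [n ne] := geo_small (d / 2 + 2) e0.
exists (S n - k n *: idfun) => //.
have -> : T - l *: idfun - (S n - k n *: idfun) = T - S n - (l - k n) *: idfun.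
  rewrite scalerBl !opprB [X in _ + X = _]addrC addrACA.
  by congr (_ + _); rewrite addrC.
apply: (opboundW (ltW ne)).
rewrite mulrDl; apply: opboundD => //; apply/opboundN.
apply: (@opboundW _ _ (Normc.normc (l - k n) * 1)); last first.
  by apply: opboundZ => x; rewrite mul1r.
by rewrite mulr1; apply: le_trans (kl n) _; rewrite mulr1.
Qed.

End ScalarPart.

(** ** Right ideals *)

Section RightIdeal.
Variables D I : set (H -> H).
Hypotheses (hD : cstar_subalgebra D) (Db : D `<=` bounded_adjointable).
Hypothesis I0 : I 0.
Hypothesis ID : forall T S, I T -> I S -> I (T + S).
Hypothesis IZ : forall (k : R[i]) T, I T -> I (k *: T).
Hypothesis IM : forall T S, I T -> D S -> I (T \o S).

Lemma closureD T S : opnorm_closure I T -> opnorm_closure I S ->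
  opnorm_closure I (T + S).
Proof.
move=> /opnorm_closureP IT /opnorm_closureP IS; apply/opnorm_closureP => e e0.
have e2 : 0 < e / 2 by rewrite divr_gt0.
have [T' IT' TT] := IT _ e2; have [S' IS' SS] := IS _ e2.
exists (T' + S'); first exact: ID.
by rewrite opprD addrACA (splitr e); exact: opboundD.
Qed.

Lemma closureZ (k : R[i]) T : opnorm_closure I T -> opnorm_closure I (k *: T).
Proof.
move=> /opnorm_closureP IT; apply/opnorm_closureP => e e0.
have k1 : 0 < Normc.normc k + 1 by rewrite ltr_wpDl ?normc_pos.
have [|T' IT' TT] := IT (e / (Normc.normc k + 1)); first by rewrite divr_gt0.
exists (k *: T'); first exact: IZ.
rewrite -scalerBr; apply: opboundW (opboundZ k TT).
by rewrite mulrCA ger_pMr// ler_pdivrMr// mul1r lerDl.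
Qed.

Lemma closureM T S : opnorm_closure I T -> D S -> opnorm_closure I (T \o S).
Proof.
move=> /opnorm_closureP IT DS; apply/opnorm_closureP => e e0.
have [_ [c c0 Sc]] := Db DS.
have [|T' IT' TT] := IT (e / c); first by rewrite divr_gt0.
exists (T' \o S); first exact: IM.
rewrite -[e](divfK (_ : c != 0)) ?gt_eqF//.
by apply: opbound_comp TT Sc; rewrite divr_ge0// ltW.
Qed.

Lemma closure_closed T : opnorm_closure (opnorm_closure I) T ->
  opnorm_closure I T.
Proof.
move=> /opnorm_closureP cl; apply/opnorm_closureP => e e0.
have e2 : 0 < e / 2 by rewrite divr_gt0.
have [S /opnorm_closureP/(_ _ e2)[S' IS' SS] TS] := cl _ e2.
by exists S' => //; rewrite -(subrKA S T) (splitr e); exact: opboundD.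
Qed.

(** The self-adjoint part of the closure of [I]: a C*-subalgebra even though
[I] is one-sided. *)
Definition star_core : set (H -> H) :=
  [set T | [/\ D T, opnorm_closure I T &
     forall S, adj T S -> opnorm_closure I S]].

Lemma star_core_subalgebra : cstar_subalgebra star_core.
Proof.
split.
- by move=> T [DT _ _]; exact: (csub_adjointable hD).
- split; [exact: csub0|exact: opnorm_closure_sub|move=> S].
  move=> /(adjoint_uniq ipH (adjoint0 ipH)) <-; exact: opnorm_closure_sub.
- move=> T S [DT IT IT'] [DS IS IS']; split; [exact: csubD|exact: closureD|].
  have [T' _ TT] := csub_has_adjoint hD DT; have [S' _ SS] := csub_has_adjoint hD DS.
  move=> U /(adjoint_uniq ipH (adjointD ipH TT SS)) <-.
  by apply: closureD; [exact: IT'|exact: IS'].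
- move=> k T [DT IT IT']; split; [exact: csubZ|exact: closureZ|].
  have [T' _ TT] := csub_has_adjoint hD DT.
  move=> U /(adjoint_uniq ipH (adjointZ k TT)) <-.
  by apply: closureZ; exact: IT'.
- move=> T S [DT IT IT'] [DS IS IS']; split; [exact: csubM|exact: closureM|].
  have [T' DT' TT] := csub_has_adjoint hD DT; have [S' _ SS] := csub_has_adjoint hD DS.
  move=> U /(adjoint_uniq ipH (adjointM TT SS)) <-.
  by apply: closureM => //; exact: IS'.
- move=> T S [DT IT IT'] TS; split; [exact: csub_star TS|exact: IT'|].
  by move=> U /(adjoint_uniq ipH (adjointC ipH TS)) <-.
move=> T hT cl; split.
- by apply: (csub_closed hD) => // e /cl[S [DS _ _] TS]; exists S.
- by apply: closure_closed => e /cl[S [_ IS _] TS]; exists S.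
move=> T' TT'; apply/closure_closed/opnorm_closureP => e e0.
have e2 : 0 < e / 2 by rewrite divr_gt0.
have [S [DS _ IS'] TS] := (opnorm_closureP _ _).1 cl _ e2.
have [S' _ SS'] := csub_has_adjoint hD DS; exists S'; first exact: IS'.
have := opbound_adjoint e2 (adjointB ipH TT' SS') TS.
by rewrite mulrC divfK.
Qed.

(** Some [S] in [I] is so close to the identity that it is invertible in [D]. *)
Lemma unit_in_closure : D idfun -> I `<=` D -> opnorm_closure I idfun -> I idfun.
Proof.
move=> D1 subID /opnorm_closureP/(_ 4^-1)[]; first by rewrite invr_gt0.
move=> S IS Sb; have DW : D (idfun - S) by apply: (csubB hD) => //; exact: subID.
have [J DJ []] := neumann_inverse hD D1 DW Sb.
by rewrite opprB addrCA subrr addr0 => <- _; exact: IM.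
Qed.

End RightIdeal.

End Subalgebras.

(** * Hilbert spaces *)

Section HilbertSpaces.
Variables (R : realType) (X : hilbertType R).
Implicit Types (x y z : X) (f g p q : X -> X).

Local Notation ip := (@xinner R X).

Lemma xinner_rnorm x : ip x x = (rnorm x ^+ 2)%:C%C.
Proof. by rewrite -xinner_norm rnormE rmorphXn. Qed.

Lemma xinnerP : inner_product ip Num.conj.
Proof.
split; [exact: xinnerDr|exact: xinner_conj|exact: rmorphD|move=> x].
by rewrite -xinner_norm => /eqP; rewrite sqrf_eq0 normr_eq0 => /eqP.
Qed.

Lemma xinnerZl (k : R[i]) x y : ip (k *: x) y = Num.conj k * ip x y.
Proof. by rewrite -[LHS]xinner_conj xinnerZr rmorphM/= xinner_conj. Qed.

Lemma rnorm_subZ x y (r t : R) : ip x y = r%:C%C ->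
  rnorm (x - t%:C%C *: y) ^+ 2 = rnorm x ^+ 2 - 2 * t * r + t ^+ 2 * rnorm y ^+ 2.
Proof.
move=> xy; have yx : ip y x = r%:C%C by rewrite -xinner_conj xy conj_Creal// complex_real.
apply: (@complexI R); rewrite -xinner_rnorm.
rewrite (ipBl xinnerP) !(ipBr xinnerP) !xinnerZl !xinnerZr xy yx.
rewrite conj_Creal ?complex_real// !xinner_rnorm.
by rewrite -!(rmorphM, rmorphB)/=; congr (_%:C)%C; ring.
Qed.

Lemma rnorm_parallelogram x y :
  rnorm (x + y) ^+ 2 + rnorm (x - y) ^+ 2 = 2 * rnorm x ^+ 2 + 2 * rnorm y ^+ 2.
Proof.
have sqE z : rnorm z ^+ 2 = complex.Re (ip z z) by rewrite xinner_rnorm.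
rewrite !sqE !mulr_natl -!raddfMn -!raddfD /=; congr complex.Re.
rewrite (ipBl xinnerP) !(ipBr xinnerP) (ipDl xinnerP) !(ipDr xinnerP).
by ring.
Qed.

Lemma rnorm_projection p x : projection ip p -> rnorm (p x) <= rnorm x.
Proof.
move=> [pp ppE]; rewrite -ler_sqr ?nnegrE ?rnorm_ge0//.
have h : ip x (p x) = (rnorm (p x) ^+ 2)%:C%C.
  by rewrite -xinner_rnorm pp -[p (p x)]/((p \o p) x) ppE.
have := rnorm_subZ 1 h; rewrite scale1r => e.
by have := sqr_ge0 (rnorm (x - p x)); rewrite e; lra.
Qed.

(** The projection theorem: by the parallelogram law a minimizing sequence for
the distance from [x] to [M] is Cauchy. *)
Lemma closed_subspace_complemented (M : set X) :
    M 0 -> (forall x y, M x -> M y -> M (x + y)) ->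
    (forall (k : R[i]) x, M x -> M (k *: x)) ->
    (forall x, (forall e : R, 0 < e -> exists2 m, M m & rnorm (x - m) <= e) -> M x) ->
  orth_complemented ip M.
Proof.
move=> M0 MD MZ Mcl x.
pose dist2 := [set rnorm (x - m) ^+ 2 | m in M]; pose d := inf dist2.
have d_inf : has_inf dist2.
  split; first by exists (rnorm (x - 0) ^+ 2); exists 0.
  by exists 0 => _ [m _ <-]; exact: sqr_ge0.
have d_le m : M m -> d <= rnorm (x - m) ^+ 2.
  by move=> Mm; apply: ge_inf; [case: d_inf|exists m].
have d0 : 0 <= d.
  by apply: lb_le_inf; [case: d_inf|move=> _ [m _ <-]; exact: sqr_ge0].
(* Excess 4^-n in the squared distance yields Cauchy gaps of order 2^-n. *)
have [m hm] : exists m : nat -> X, forall n,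
    M (m n) /\ rnorm (x - m n) ^+ 2 <= d + (2 ^- n) ^+ 2.
  suff sol n : exists m, M m /\ rnorm (x - m) ^+ 2 <= d + (2 ^- n) ^+ 2.
    by have [m mP] := choice sol; exists m.
  have s0 : 0 < (2 ^- n) ^+ 2 :> R by rewrite exprn_gt0 ?invr_gt0 ?exprn_gt0.
  have [_ [y My <-] yd] := inf_adherent s0 d_inf.
  by exists y; split=> //; exact: ltW.
have m_cauchy i j : (i <= j)%N -> rnorm (m j - m i) <= 2 / 2 ^+ i.
  move=> ij; rewrite -ler_sqr ?nnegrE ?rnorm_ge0 ?divr_ge0 ?exprn_ge0//.
  have := rnorm_parallelogram (x - m i) (x - m j).
  have -> : x - m i - (x - m j) = m j - m i by rewrite opprB addrC subrKA.
  have -> : x - m i + (x - m j) = 2%:C%C *: (x - (2^-1)%:C%C *: (m i + m j)).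
    rewrite scalerBr scalerA -rmorphM/= divff// scale1r addrACA -opprD.
    by rewrite rmorph_nat scaler_nat mulr2n.
  have := d_le _ (MZ (2^-1)%:C%C _ (MD _ _ (hm i).1 (hm j).1)).
  rewrite rnormZr exprMn ger0_norm// => h1 h2.
  have := (hm i).2; have := (hm j).2.
  have : (2 ^- j) ^+ 2 <= (2 ^- i) ^+ 2 :> R.
    by rewrite ler_sqr ?nnegrE ?invr_ge0 ?exprn_ge0// lef_pV2 ?posrE ?exprn_gt0//
      ler_weXn2l// ler1n.
  rewrite exprMn; move: h1 h2.
  move: ((2 ^- i) ^+ 2) ((2 ^- j) ^+ 2) => u v; nra.
have [l lm] := geo_cauchy m_cauchy.
have Ml : M l.
  apply: Mcl => e /(geo_small 2)[n ne]; exists (m n); first by case: (hm n).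
  by rewrite (le_trans (lm n)) ?ltW.
have l_min y : M y -> rnorm (x - l) ^+ 2 <= rnorm (x - y) ^+ 2.
  move=> /d_le; apply: le_trans; rewrite -(sqr_sqrtr d0).
  rewrite ler_sqr ?nnegrE ?rnorm_ge0 ?sqrtr_ge0// -subr_le0.
  apply: (@geo_le0 _ _ 3) => n; rewrite lerBlDr.
  have mn : rnorm (x - m n) <= 2 ^- n + Num.sqrt d.
    rewrite -ler_sqr ?nnegrE ?rnorm_ge0 ?addr_ge0 ?sqrtr_ge0 ?invr_ge0 ?exprn_ge0//.
    apply: le_trans (hm n).2 _; rewrite sqrrD sqr_sqrtr//.
    by rewrite [leLHS]addrC lerD2r lerDl mulrn_wge0// mulr_ge0 ?sqrtr_ge0 ?invr_ge0 ?exprn_ge0.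
  have := rnormBD (m n) x l; have := lm n; rewrite (rnormC l).
  move: mn; move: (2 ^- n) => u; lra.
exists l, (x - l); split=> //; last by rewrite addrC subrK.
move=> y My; apply/eqP/negP => /negP c0; set c := ip y (x - l) in c0.
have cE : ip (x - l) (c *: y) = (Normc.normc c ^+ 2)%:C%C.
  rewrite xinnerZr -xinner_conj -/c; rewrite rmorphXn/= -[(Normc.normc c)%:C%C]/`|c|.
  by rewrite normCK.
have cpos : 0 < Normc.normc c ^+ 2.
  rewrite exprn_gt0// lt_def normc_pos andbT.
  by apply: contra_neq c0 => /Normc.eq0_normc.
have y1 : 0 < 1 + rnorm y ^+ 2 by rewrite ltr_pwDl// sqr_ge0.
(* Moving l by t c y shortens the squared distance by t |c|^2 (2 - t |y|^2). *)
pose t := (1 + rnorm y ^+ 2)^-1.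
have := l_min (l + t%:C%C *: (c *: y)) (MD _ _ Ml (MZ _ _ (MZ _ _ My))).
rewrite opprD addrA (rnorm_subZ _ cE) rnormZ exprMn => h.
have t0 : 0 < t by rewrite invr_gt0.
have ty : t * rnorm y ^+ 2 <= 1 by rewrite mulrC ler_pdivrMr// mul1r lerDr.
have {h} : t * Normc.normc c ^+ 2 * (2 - t * rnorm y ^+ 2) <= 0.
  by move: h; move: (rnorm _ ^+ 2) (Normc.normc c ^+ 2) (rnorm y ^+ 2) => u v w; nra.
by apply/negP; rewrite -ltNge; apply: mulr_gt0; [exact: mulr_gt0|lra].
Qed.

Lemma range_meet_complemented p q :
    projection ip p -> projection ip q -> bounded_linear p -> bounded_linear q ->
  orth_complemented ip (range q `&` range p).
Proof.
move=> hp hq [lp _] [lq _].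
have lin0 (f : X -> X) : linear f -> f 0 = 0.
  by move=> lf; have := lf (-1) 0 0; rewrite scaler0 addr0 scaleN1r addNr.
have cl p' x : projection ip p' -> linear p' -> (forall e : R, 0 < e ->
    exists2 m, p' m = m & rnorm (x - m) <= e) -> p' x = x.
  move=> hp' lp' cl; apply/eqP; rewrite -subr_eq0; apply/eqP/rnorm0_eq0.
  apply/ler_addgt0Pr => e e0; rewrite add0r.
  have [|m pm xm] := cl (e / 2); first by rewrite divr_gt0.
  apply: le_trans (rnormBD m _ _) _; rewrite (splitr e) lerD//; last by rewrite rnormC.
  apply: le_trans xm; rewrite -{1}pm.
  have -> : p' x - p' m = p' (x - m).
    by have := lp' (-1) m x; rewrite !scaleN1r ![- _ + _]addrC.
  exact: rnorm_projection.
apply: closed_subspace_complemented.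
- by split; [apply/(proj_rangeP _ hq)|apply/(proj_rangeP _ hp)]; exact: lin0.
- move=> x y [/(proj_rangeP _ hq) qx /(proj_rangeP _ hp) px].
  move=> [/(proj_rangeP _ hq) qy /(proj_rangeP _ hp) py].
  split; [apply/(proj_rangeP _ hq)|apply/(proj_rangeP _ hp)].
    by have := lq 1 x y; rewrite !scale1r qx qy.
  by have := lp 1 x y; rewrite !scale1r px py.
- move=> k x [/(proj_rangeP _ hq) qx /(proj_rangeP _ hp) px].
  split; [apply/(proj_rangeP _ hq)|apply/(proj_rangeP _ hp)].
    by have := lq k x 0; rewrite !addr0 qx (lin0 q)// addr0.
  by have := lp k x 0; rewrite !addr0 px (lin0 p)// addr0.
move=> x xcl; split; [apply/(proj_rangeP _ hq)|apply/(proj_rangeP _ hp)].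
  apply: cl => // e /xcl[m [/(proj_rangeP _ hq) qm _] xm]; by exists m.
apply: cl => // e /xcl[m [_ /(proj_rangeP _ hp) pm] xm]; by exists m.
Qed.

Lemma xadjointZ (k : R[i]) f g : adjoint_of ip f g ->
  adjoint_of ip (k *: f) (Num.conj k *: g).
Proof. by move=> fg x y; rewrite xinnerZl xinnerZr fg. Qed.

Lemma xadjointableZ f (k : R[i]) x : adjointable ip f -> f (k *: x) = k *: f x.
Proof.
move=> [g /(adjointC xinnerP) gf]; apply: (ip_extr xinnerP) => z.
by rewrite -gf !xinnerZr gf.
Qed.

(** ** Representations *)

Section Representations.
Variables (A : cstarAlgType R) (H : hilbertModType A) (D : set (H -> H)).
Variable pi : (H -> H) -> (X -> X).
Hypothesis hD : cstar_subalgebra D.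
Hypotheses (D1 : D idfun) (hpi : representation D pi).

Local Notation adj := (adjoint_of (@hinner R A H)).
Local Notation ipH := (@hinnerP R A H).

Lemma rep_linear T : D T -> linear (pi T).
Proof. by move=> /(rep_bounded hpi)[]. Qed.

Lemma rep0 T : D T -> pi T 0 = 0.
Proof.
by move=> /rep_linear lT; have := lT (-1) 0 0; rewrite scaler0 addr0 scaleN1r addNr.
Qed.

Lemma repN T : D T -> pi (- T) = - pi T.
Proof. by move=> DT; rewrite -[in LHS]scaleN1r (repZ hpi)// scaleN1r. Qed.

Lemma repB T S : D T -> D S -> pi (T - S) = pi T - pi S.
Proof.
by move=> DT DS; rewrite (repD hpi)// ?repN//; exact: (csubN hD).
Qed.

Lemma rep1 T x : D T -> pi idfun (pi T x) = pi T x /\ pi T (pi idfun x) = pi T x.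
Proof.
by move=> DT; split; [have /(congr1 (@^~ x)) := repM hpi D1 DT|
  have /(congr1 (@^~ x)) := repM hpi DT D1].
Qed.

Lemma rep_projection T : D T -> projection (@hinner R A H) T ->
  projection ip (pi T).
Proof.
move=> DT [TT T2]; split; first exact: (rep_star hpi).
by rewrite -(repM hpi)// T2.
Qed.

(** Let [m] be the best constant in |pi T x|^2 <= m |x|^2.  Near the supremum
of the quotient, [x] is almost an eigenvector of [a = pi (T' T)], where [T'] is the
adjoint of [T], for the value [m], so that [m - a] is not bounded below.  But for
[m > 9 c^2] the operator [m - T' T] is invertible in [D] by a Neumann series, and
[pi] transports the inverse. *)
Lemma rep_continuous T (c : R) : D T -> 0 < c -> opbound c T ->
  opbound (3 * c) (pi T).
Proof.
move=> DT c0 Tc.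
have [T' DT' TT] := csub_has_adjoint hD DT.
have DTT : D (T' \o T) by exact: (csubM hD).
set s := pi T; set a := pi (T' \o T).
have sa x y : ip (s x) (s y) = ip (a x) y.
  by rewrite /a (repM hpi)// -(rep_star hpi DT' (adjointC (@hinnerP _ _ _) TT)).
have asq x : ip (a x) x = (rnorm (s x) ^+ 2)%:C%C.
  by rewrite -sa xinner_rnorm.
(* The sign condition keeps the set bounded below when X is trivial. *)
pose bounds := [set m : R | 0 <= m /\ forall x, rnorm (s x) ^+ 2 <= m * rnorm x ^+ 2].
have bounds0 : has_inf bounds.
  split; last by exists 0 => m [].
  have [_ [M /opbound_real[d d0 sd]]] := rep_bounded hpi DT.
  exists (d ^+ 2); split; first exact: sqr_ge0.
  by move=> x; rewrite -exprMn ler_sqr ?nnegrE ?rnorm_ge0 ?mulr_ge0 ?(ltW d0) ?rnorm_ge0.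
pose m := inf bounds.
have m0 : 0 <= m by apply: lb_le_inf; [case: bounds0|move=> ? []].
have mP x : rnorm (s x) ^+ 2 <= m * rnorm x ^+ 2.
  apply/ler_addgt0Pr => e e0.
  have x1 : 0 < 1 + rnorm x ^+ 2 by rewrite ltr_pwDl// sqr_ge0.
  have [|k [k0 kP] km] := @inf_adherent _ bounds (e / (1 + rnorm x ^+ 2)) _ bounds0.
    by rewrite divr_gt0.
  apply: le_trans (kP x) _.
  apply: le_trans (_ : (m + e / (1 + rnorm x ^+ 2)) * rnorm x ^+ 2 <= _).
    by rewrite ler_wpM2r ?sqr_ge0// ltW.
  by rewrite mulrDl lerD2l mulrAC ler_pdivrMr// ler_pM2l// lerDr.
suff mc : m <= 9 * c ^+ 2.
  move=> x; rewrite -ler_sqr ?nnegrE ?rnorm_ge0 ?mulr_ge0 ?(ltW c0) ?rnorm_ge0//.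
  apply: le_trans (mP x) _; rewrite exprMn ler_wpM2r ?sqr_ge0//.
  by rewrite exprMn; lra.
rewrite leNgt; apply/negP => cm.
have mp : 0 < m by apply: le_lt_trans cm; rewrite mulr_ge0 ?sqr_ge0.
pose W := (m^-1)%:C%C *: (T' \o T).
have DW : D W by exact: (csubZ hD).
have Wb : opbound (4^-1) W.
  have := opboundZ (m^-1)%:C%C (opbound_comp _ (opbound_adjoint c0 TT Tc) Tc).
  rewrite mulr_ge0 ?(ltW c0)// => /(_ isT); apply: opboundW.
  rewrite /= expr0n addr0 sqrtr_sqr ger0_norm ?invr_ge0// mulrC.
  by rewrite ler_pdivrMr//; move: cm; rewrite expr2; lra.
have [J DJ [_ JW]] := neumann_inverse hD D1 DW Wb.
have [_ [M /opbound_real[b b0 Jb]]] := rep_bounded hpi DJ.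
(* B > 1 is a bound for the image of the inverse of 1 - T' T / m. *)
pose B := b + 1; have B1 : 1 < B by rewrite ltrDr.
pose e := pi idfun.
have se x : s (e x) = s x by exact: (rep1 x DT).2.
have ae x : a (e x) = a x by exact: (rep1 x DTT).2.
have eB x : rnorm (e x) ^+ 2 <=
    B ^+ 2 * rnorm (e x - (m^-1)%:C%C *: a (e x)) ^+ 2.
  have {1}-> : e x = pi J (e x - (m^-1)%:C%C *: a (e x)).
    rewrite ae /e -[in LHS]JW (repM hpi) ?repB//; last exact: (csubB hD).
    by rewrite /W (repZ hpi).
  rewrite -exprMn ler_sqr ?nnegrE ?rnorm_ge0 ?mulr_ge0 ?rnorm_ge0//; last by lra.
  by apply: le_trans (Jb _) _; rewrite ler_wpM2r ?rnorm_ge0// lerDl.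
(* Expand 0 <= |s (a x) - m (s x)|^2, where |s (a x)|^2 <= m |a x|^2. *)
have aB x : rnorm (a x) ^+ 2 <= m * rnorm (s x) ^+ 2.
  have h : ip (s (a x)) (s x) = (rnorm (a x) ^+ 2)%:C%C.
    by rewrite -xinner_conj sa xinner_rnorm conj_Creal// complex_real.
  have := sqr_ge0 (rnorm (s (a x) - m%:C%C *: s x)).
  rewrite (rnorm_subZ _ h); have := mP (a x).
  move: (_ ^+ 2) (rnorm (s x) ^+ 2) (rnorm _ ^+ 2) => u v w.
  by move=> h1 h2; rewrite -(ler_pM2l mp); move: h2; rewrite expr2; lra.
(* A strictly smaller constant, contradicting the choice of m. *)
have hm : bounds (m * (1 - B ^- 2)).
  have B2 : 1 < B ^+ 2 by rewrite exprn_egt1.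
  split; first by rewrite mulr_ge0// subr_ge0 invf_le1 ?ltW// (lt_trans ltr01).
  move=> x; rewrite -se.
  apply: le_trans (_ : m * (1 - B ^- 2) * rnorm (e x) ^+ 2 <= _); last first.
    rewrite ler_wpM2l//.
      by rewrite mulr_ge0// subr_ge0 invf_le1 ?ltW// (lt_trans ltr01).
    rewrite ler_sqr ?nnegrE ?rnorm_ge0//; apply: rnorm_projection.
    by apply: rep_projection => //; split.
  have h : ip (e x) (a (e x)) = (rnorm (s (e x)) ^+ 2)%:C%C.
    by rewrite -xinner_conj asq conj_Creal// complex_real.
  have := eB x; rewrite (rnorm_subZ _ h); have := aB (e x).
  move: (rnorm (a (e x)) ^+ 2) (rnorm (s (e x)) ^+ 2) (rnorm (e x) ^+ 2) => u v w uv.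
  move=> wB; have {wB} : w <= B ^+ 2 * (w - m^-1 * v).
    apply: le_trans wB _; rewrite ler_wpM2l ?sqr_ge0//.
    have : m^-1 ^+ 2 * u <= m^-1 * v.
      by rewrite expr2 -mulrA ler_wpM2l ?invr_ge0// mulrC ler_pdivrMr// mulrC.
    by lra.
  rewrite -ler_pdivrMl ?(lt_trans ltr01)// => h1.
  have h2 : m^-1 * v <= (1 - B ^- 2) * w by rewrite mulrBl mul1r; lra.
  by move: h2; rewrite ler_pdivrMl// mulrA.
have := ge_inf bounds0.2 hm.
apply/negP; rewrite -ltNge -/m gtr_pMr// ltrBlDr ltrDl invr_gt0 exprn_gt0//.
by rewrite (lt_trans ltr01).
Qed.

(** Closedness is where continuity of [pi] enters. *)
Lemma commutant_subalgebra f : projection ip f ->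
  cstar_subalgebra [set T | D T /\ pi T \o f = f \o pi T].
Proof.
move=> hf; have [ff _] := hf.
have af : adjointable ip f by exists f.
have comm T x : pi T \o f = f \o pi T -> pi T (f x) = f (pi T x).
  by move=> /(congr1 (@^~ x)).
split.
- by move=> T [DT _]; exact: (csub_adjointable hD).
- have D0 := csub0 hD; split=> //; apply/funext => x /=.
  rewrite -(scale0r (0 : H -> H)) (repZ hpi)// !scale0r.
  by rewrite -[RHS]/(f 0) (adjointable0 xinnerP af).
- move=> T S [DT Tf] [DS Sf]; split; first exact: csubD.
  apply/funext => x /=; rewrite (repD hpi)// !fctE (adjointableD xinnerP _ _ af).
  by rewrite !comm.
- move=> k T [DT Tf]; split; first exact: csubZ.
  by apply/funext => x /=; rewrite (repZ hpi)// !fctE xadjointableZ// comm.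
- move=> T S [DT Tf] [DS Sf]; split; first exact: csubM.
  by apply/funext => x /=; rewrite (repM hpi)//= !comm.
- move=> T S [DT Tf] TS; have DS := csub_star hD DT TS; split=> //.
  have pTS := rep_star hpi DT TS.
  by apply: (adjoint_uniq xinnerP (adjointM ff pTS)); rewrite -Tf; exact: adjointM.
move=> T hT cl.
have DT : D T by apply: (csub_closed hD) => // e /cl[S [DS _] TS]; exists S.
split=> //; apply/funext => x /=; apply/eqP; rewrite -subr_eq0.
apply/eqP/rnorm0_eq0/ler_addgt0Pr => e e0; rewrite add0r.
have x1 : 0 < 6 * (1 + rnorm x) by rewrite mulr_gt0// ltr_pwDl ?rnorm_ge0.
pose d := e / (6 * (1 + rnorm x)); have d0 : 0 < d by rewrite divr_gt0.
have [S [DS Sf] TS] := (opnorm_closureP _ _).1 cl _ d0.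
have bd := rep_continuous (csubB hD DT DS) d0 TS.
have -> : pi T (f x) - f (pi T x) = pi (T - S) (f x) - f (pi (T - S) x).
  rewrite repB// !fctE (adjointableB xinnerP _ _ af) -(comm S)//.
  by rewrite opprB subrKA.
apply: le_trans (rnormB _ _) _.
have h1 : rnorm (pi (T - S) (f x)) <= 3 * d * rnorm x.
  apply: le_trans (bd _) _; rewrite ler_wpM2l ?rnorm_projection//.
    by rewrite mulr_ge0// ltW.
have h2 : rnorm (f (pi (T - S) x)) <= 3 * d * rnorm x.
  exact: le_trans (rnorm_projection _ hf) (bd _).
have : d * (6 * (1 + rnorm x)) = e by rewrite divfK ?gt_eqF.
by move: d0; lra.
Qed.

(** Multiplying [1 = P a + Q b] by [1 - P] gives [1 - P = (1 - P) Q b].  Hence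
[Q - Q b (1 - P) Q] maps into the intersection of the ranges of [P] and [Q], and
[Q = Q b (1 - P) Q].  The image of the right-hand side under [pi] vanishes on the
common fixed vectors of [pi P] and [pi Q]. *)
Lemma no_common_fixed_vector (P Q a b : H -> H) x :
    D P -> D Q -> D a -> D b ->
    projection (@hinner R A H) P -> projection (@hinner R A H) Q ->
    (forall y : H, P y = y -> Q y = y -> y = 0) ->
    (P \o a) + (Q \o b) = idfun -> set_inj D pi ->
  pi P x = x -> pi Q x = x -> x = 0.
Proof.
move=> DP DQ Da Db' hP hQ PQ0 ab inj px qx.
have [_ P2] := hP; have [_ Q2] := hQ.
have PP (y : H) : P (P y) = P y by rewrite -[LHS]/((P \o P) y) P2.
have QQ (y : H) : Q (Q y) = Q y by rewrite -[LHS]/((Q \o Q) y) Q2.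
have aP := csub_adjointable hD DP; have aQ := csub_adjointable hD DQ.
have QE : Q = Q \o (b \o ((idfun - P) \o Q)).
  apply/funext => y /=; rewrite !fctE /=.
  apply/eqP; rewrite -subr_eq0; apply/eqP; set u := Q y - P (Q y).
  have Pu : P u = 0 by rewrite (adjointableB ipH _ _ aP) PP subrr.
  have uE : u = P (a u) + Q (b u) by rewrite -[RHS]/(((P \o a) + (Q \o b)) u) ab.
  have uE' : u = Q (b u) - P (Q (b u)).
    transitivity (u - P u); first by rewrite Pu subr0.
    rewrite {1 2}uE (adjointableD ipH _ _ aP) PP.
    by rewrite opprD addrACA subrr add0r.
  apply: PQ0; last by rewrite (adjointableB ipH _ _ aQ) !QQ.
  apply/esym/eqP; rewrite -subr_eq0 (adjointableB ipH _ _ aP).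
  by rewrite opprD addrACA -opprD -/u -uE' subrr.
have D1P : D (idfun - P) by exact: (csubB hD).
have Dr : D ((idfun - P) \o Q) by exact: (csubM hD).
have Dbr : D (b \o ((idfun - P) \o Q)) by exact: (csubM hD).
have e1 := (rep1 x DP).1; rewrite px in e1.
rewrite -qx [in pi Q]QE (repM hpi)//= (repM hpi)//= (repM hpi)//= repB// !fctE.
by rewrite qx px e1 subrr !rep0.
Qed.

End Representations.

End HilbertSpaces.

(** * Twisting a representation by a character *)

Section Twist.
Variables (R : realType) (A : cstarAlgType R) (H : hilbertModType A).
Variables (X : hilbertType R) (D : set (H -> H)) (pi : (H -> H) -> (X -> X)).
Variables (f : X -> X) (chi : (H -> H) -> R[i]).
Hypotheses (hD : cstar_subalgebra D) (D1 : D idfun) (hpi : representation D pi).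
Hypotheses (hf : projection (@xinner R X) f)
  (pif : forall T x, D T -> pi T (f x) = f (pi T x)).
Hypotheses
  (chiD : forall T S, D T -> D S -> chi (T + S) = chi T + chi S)
  (chiZ : forall (k : R[i]) T, D T -> chi (k *: T) = k * chi T)
  (chiM : forall T S, D T -> D S -> chi (T \o S) = chi T * chi S)
  (chi_star : forall T S, D T -> adjoint_of (@hinner R A H) T S ->
    chi S = Num.conj (chi T)).

Local Notation ip := (@xinner R X).
Local Notation adj := (adjoint_of (@hinner R A H)).
Local Notation ipX := (@xinnerP R X).

(** [pi] off the range of [f], the scalar [chi] on it. *)
Definition twist (T : H -> H) : X -> X := pi T - (pi T \o f) + chi T *: f.

Let af : adjointable ip f. Proof. by exists f; case: hf. Qed.

Let ff x : f (f x) = f x.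
Proof. by case: hf => _ /(congr1 (@^~ x)). Qed.

Let pi_adjointable T : D T -> adjointable ip (pi T).
Proof.
move=> DT; have [S DS TS] := csub_has_adjoint hD DT.
by exists (pi S); exact: (rep_star hpi).
Qed.

Lemma twist_star T S : D T -> adj T S -> adjoint_of ip (twist T) (twist S).
Proof.
move=> DT TS; have pTS := rep_star hpi DT TS; have DS := csub_star hD DT TS.
have adjf : adjoint_of ip f f by case: hf.
apply: (adjointD ipX); last by rewrite (chi_star DT TS); exact: xadjointZ.
apply: (adjointB ipX) => //.
have -> : pi S \o f = f \o pi S by apply/funext => x; exact: pif.
exact: adjointM.
Qed.

Lemma twist_representation : representation D twist.
Proof.
split.
- move=> T DT; have [S DS TS] := csub_has_adjoint hD DT.
  have aT : adjointable ip (twist T) by exists (twist S); exact: twist_star.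
  split; first by move=> k x y; rewrite (adjointableD ipX)// xadjointableZ.
  have [_ [_ /opbound_real[c c0 Tc]]] := rep_bounded hpi DT.
  exists (c + c * 1 + Normc.normc (chi T) * 1)%:C%C => x.
  rewrite !rnormE -[_ * _](rmorphM (real_complex R)) lecR; move: x.
  have fb : opbound 1 f by move=> x; rewrite mul1r; exact: rnorm_projection.
  apply: opboundD; last exact: opboundZ.
  apply: opboundD => //; apply: opboundN; apply: opbound_comp fb => //.
  exact: ltW.
- move=> T S DT DS; rewrite /twist (repD hpi)// chiD//.
  by apply/funext => x; rewrite !fctE /= scalerDl opprD addrACA; congr (_ + _); rewrite addrACA.
- move=> k T DT; rewrite /twist (repZ hpi)// chiZ//.
  by apply/funext => x; rewrite !fctE /= scalerDr scalerBr scalerA.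
- move=> T S DT DS; rewrite /twist (repM hpi)// chiM//.
  apply/funext => x; rewrite !fctE /=.
  set y := pi S x - pi S (f x).
  have fy : f y = 0 by rewrite /y (adjointableB ipX)// -!pif// ff subrr.
  rewrite (adjointableD ipX _ _ af) fy add0r (xadjointableZ _ _ af) ff.
  rewrite (adjointableD ipX _ _ (pi_adjointable DT)) addrK scalerA; congr (_ + _).
  by rewrite /y (adjointableB ipX _ _ (pi_adjointable DT)).
- exact: twist_star.
Qed.

(** Evaluate at [f x] to see that the scalar part contributes nothing. *)
Lemma twist_ker T x : D T -> twist T = 0 -> pi T x = f (pi T x).
Proof.
move=> DT /[dup] /(congr1 (@^~ x)) + /(congr1 (@^~ (f x))).
rewrite /twist !fctE /= ff subrr add0r => + chi0.
by rewrite [X in _ + X]chi0 addr0 => /subr0_eq ->; rewrite -pif// ff.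
Qed.

End Twist.

(** * The inner and the outer algebra *)

Section InnerOuter.
Variables (R : realType) (A : cstarAlgType R) (H : hilbertModType A).
Variables (P Q : H -> H) (hPQ : matched P Q).
Variables (X : hilbertType R) (pi : (H -> H) -> (X -> X)).
Hypothesis hpi : faithful_representation (outer_algebra P Q) pi.

Local Notation ip := (@hinner R A H).
Local Notation ipH := (@hinnerP R A H).
Local Notation ipX := (@xinnerP R X).
Local Notation O := (outer_algebra P Q).

Let E := hmeet P Q.
Let projP : projection ip P. Proof. by case: hPQ. Qed.
Let projQ : projection ip Q. Proof. by case: hPQ. Qed.
Let comp : orth_complemented ip (range Q `&` range P). Proof. by case: hPQ. Qed.
Let absE := meet_absorbs ipH projP projQ comp.
Let projE : projection ip E. Proof. by case: absE. Qed.

Let projection_bounded T : projection ip T -> bounded_adjointable T.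
Proof.
move=> hT; split; first by exists T; case: hT.
by exists 2 => //; exact: opbound_projection.
Qed.

Let gens : [set P; Q; E; idfun] `<=` @bounded_adjointable R A H.
Proof. by move=> T [[[->|->]|->]|->]; exact: projection_bounded. Qed.

Let hO : cstar_subalgebra O.
Proof. exact: cstar_generated_subalgebra. Qed.
Let Ob : O `<=` @bounded_adjointable R A H.
Proof. exact: cstar_generated_bounded. Qed.
Let OP : O P. Proof. by apply: sub_gen_smallest; left; left; left. Qed.
Let OQ : O Q. Proof. by apply: sub_gen_smallest; left; left; right. Qed.
Let OE : O E. Proof. by apply: sub_gen_smallest; left; right. Qed.
Let O1 : O idfun. Proof. by apply: sub_gen_smallest; right. Qed.
Let P1 := P - E.
Let Q1 := Q - E.
Let OP1 : O P1. Proof. exact: (csubB hO). Qed.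
Let OQ1 : O Q1. Proof. exact: (csubB hO). Qed.
Let projP1 : projection ip P1.
Proof. by apply: (projection_sub ipH) => //; case: absE. Qed.
Let projQ1 : projection ip Q1.
Proof. by apply: (projection_sub ipH) => //; case: absE. Qed.

(** Such an [x] is killed by [E], hence fixed by [P] and [Q], hence by [E]. *)
Lemma reduced_ranges_disjoint (x : H) : P1 x = x -> Q1 x = x -> x = 0.
Proof.
have [_ _ _ EP _] := absE; have [_ EE] := projE.
move=> Px Qx; have Ex : E x = 0.
  rewrite -Px /P1 !fctE (adjointableB ipH); last by exists E; case: projE.
  by rewrite -[E (P x)]/((E \o P) x) -[E (E x)]/((E \o E) x) [E \o P]EP EE subrr.
rewrite -Ex; apply/esym; apply: (meet_id ipH) => //.
  by rewrite -[RHS]Px /P1 !fctE Ex subr0.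
by rewrite -[RHS]Qx /Q1 !fctE Ex subr0.
Qed.

Let I := inner_algebra P Q.

Let gensI : [set P1; Q1; idfun] `<=` O.
Proof. by move=> T [[->|->]|->]. Qed.
Let hI : cstar_subalgebra I.
Proof. by apply: cstar_generated_subalgebra => T /gensI/Ob. Qed.
Let IO : I `<=` O.
Proof. exact: smallest_sub. Qed.
Let I1 : I idfun. Proof. by apply: sub_gen_smallest; right. Qed.
Let IP1 : I P1. Proof. by apply: sub_gen_smallest; left; left. Qed.
Let IQ1 : I Q1. Proof. by apply: sub_gen_smallest; left; right. Qed.

Let repO : representation O pi. Proof. by case: hpi. Qed.
Let injO : set_inj O pi. Proof. by case: hpi. Qed.

Let repI : representation I pi.
Proof.
split.
- by move=> T /IO; exact: rep_bounded.
- by move=> T S /IO ? /IO ?; exact: (repD repO).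
- by move=> k T /IO ?; exact: (repZ repO).
- by move=> T S /IO ? /IO ?; exact: (repM repO).
- by move=> T S /IO ?; exact: (rep_star repO).
Qed.

Let N := @cstar_generated R A H [set P1; Q1].

Let rid : set (H -> H) :=
  [set T | exists a b, [/\ O a, O b & T = (P1 \o a) + (Q1 \o b)]].

(** The closed right ideal [rid] is not self-adjoint, but its [star_core] is a
C*-subalgebra, which contains the two generators. *)
Lemma generated_sub_closure : N `<=` opnorm_closure rid.
Proof.
have aP1 := csub_adjointable hO OP1; have aQ1 := csub_adjointable hO OQ1.
have core : cstar_subalgebra (star_core O rid).
  apply: star_core_subalgebra => //.
  - exists 0, 0; split; [exact: (csub0 hO)|exact: (csub0 hO)|].
    apply/funext => x; rewrite -[RHS]/(P1 0 + Q1 0).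
    by rewrite (adjointable0 ipH aP1) (adjointable0 ipH aQ1) addr0.
  - move=> _ _ [a [b [Oa Ob_ ->]]] [c [d [Oc Od ->]]].
    exists (a + c), (b + d); split; [exact: (csubD hO)|exact: (csubD hO)|].
    apply/funext => x; rewrite !fctE /=.
    by rewrite (adjointableD ipH _ _ aP1) (adjointableD ipH _ _ aQ1) addrACA.
  - move=> k _ [a [b [Oa Ob_ ->]]].
    exists (k *: a), (k *: b); split; [exact: (csubZ hO)|exact: (csubZ hO)|].
    apply/funext => x; rewrite !fctE /=.
    by rewrite (adjointableZ _ _ aP1) (adjointableZ _ _ aQ1) scalerDr.
  - move=> _ S [a [b [Oa Ob_ ->]]] OS.
    by exists (a \o S), (b \o S); split; [exact: (csubM hO)|exact: (csubM hO)|].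
suff sub : N `<=` star_core O rid by move=> T /sub[].
have ridP1 : rid P1.
  exists idfun, 0; split=> //; first exact: (csub0 hO).
  by apply/funext => x; rewrite -[RHS]/(P1 x + Q1 0) (adjointable0 ipH aQ1) addr0.
have ridQ1 : rid Q1.
  exists 0, idfun; split=> //; first exact: (csub0 hO).
  by apply/funext => x; rewrite -[RHS]/(P1 0 + Q1 x) (adjointable0 ipH aP1) add0r.
apply: smallest_sub => // T [->|->]; split=> //; try exact: opnorm_closure_sub.
  by case: projP1 => adjP1 _ S /(adjoint_uniq ipH adjP1) <-; exact: opnorm_closure_sub.
by case: projQ1 => adjQ1 _ S /(adjoint_uniq ipH adjQ1) <-; exact: opnorm_closure_sub.
Qed.

Lemma idfun_notin_generated (x : X) : pi P1 x = x -> pi Q1 x = x -> x <> 0 -> ~ N idfun.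
Proof.
move=> px qx x0 /generated_sub_closure N1; apply: x0.
have [a [b [Oa Ob_ ab]]] : rid idfun.
  apply: (unit_in_closure hO _ O1 _ N1).
    move=> _ S [a [b [Oa Ob_ ->]]] OS.
    by exists (a \o S), (b \o S); split; [exact: (csubM hO)|exact: (csubM hO)|].
  move=> _ [a [b [Oa Ob_ ->]]].
  by apply: (csubD hO); exact: (csubM hO).
by apply: (no_common_fixed_vector hO O1 repO OP1 OQ1 Oa Ob_) => //;
  exact: reduced_ranges_disjoint.
Qed.

Let p := pi P.
Let q := pi Q.
Let e := pi E.
Let f := xmeet p q.
Let g := f - e.

Let projp : projection (@xinner R X) p. Proof. exact: (rep_projection repO). Qed.
Let projq : projection (@xinner R X) q. Proof. exact: (rep_projection repO). Qed.
Let proje : projection (@xinner R X) e. Proof. exact: (rep_projection repO). Qed.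
Let compX := range_meet_complemented projp projq
  (rep_bounded repO OP) (rep_bounded repO OQ).
Let absF := meet_absorbs ipX projp projq compX.
Let projf : projection (@xinner R X) f. Proof. by case: absF. Qed.

(** The range of [e] consists of common fixed vectors of [p] and [q], but [f]
may be strictly larger. *)
Let fe : f \o e = e.
Proof.
have [_ PE QE _ _] := absE; apply/funext => x; apply: (meet_id ipX) => //.
  by rewrite -[LHS]/((p \o e) x) -(repM repO)// PE.
by rewrite -[LHS]/((q \o e) x) -(repM repO)// QE.
Qed.

Let ef : e \o f = e.
Proof. by apply: (selfadjoint_absorbC ipX) => //; [case: projf|case: proje]. Qed.

Let projg : projection (@xinner R X) g.
Proof. exact: (projection_sub ipX). Qed.

(** On the range of [g] the projection [e] vanishes, while [pi T] fixes the
range of [f]. *)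
Let fix_g T : O T -> T \o E = E -> pi T \o f = f -> pi (T - E) \o g = g.
Proof.
move=> OT TE Tf; apply/funext => x /=; rewrite (repB hO repO)// /g !fctE.
have [T' _ TT] := csub_has_adjoint hO OT.
rewrite (adjointableB ipX); last by exists (pi T'); exact: (rep_star repO).
rewrite (adjointableB ipX); last by exists e; case: proje.
rewrite -[pi T (f x)]/((pi T \o f) x) Tf -[pi T (e x)]/((pi T \o e) x).
rewrite -(repM repO)// TE -/e -[e (f x)]/((e \o f) x) ef.
by rewrite -[e (e x)]/((e \o e) x) (proj2 proje) subrr subr0.
Qed.

Let p1g : pi P1 \o g = g.
Proof. by case: absE absF => _ PE _ _ _ [_ pf _ _ _]; exact: fix_g. Qed.
Let q1g : pi Q1 \o g = g.
Proof. by case: absE absF => _ _ QE _ _ [_ _ qf _ _]; exact: fix_g. Qed.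
Let e1g : pi idfun \o g = g.
Proof. by rewrite -p1g; apply/funext => x /=; have [] := rep1 O1 repO (g x) OP1. Qed.

Let commute T x : I T -> pi T (g x) = g (pi T x).
Proof.
have projT S : O S -> projection ip S -> pi S \o g = g -> pi S \o g = g \o pi S.
  move=> OS hS Sg; rewrite Sg; apply/esym/(selfadjoint_absorbC ipX) => //.
    by case: (rep_projection repO OS hS).
  by case: projg.
suff sub : I `<=` [set T | O T /\ pi T \o g = g \o pi T].
  by move=> /sub[_ /(congr1 (@^~ x))].
apply: smallest_sub; first exact: (commutant_subalgebra hO O1 repO).
by move=> S [[->|->]|->]; split=> //; exact: projT.
Qed.

Let piP1 : pi P1 = p - e. Proof. exact: (repB hO repO). Qed.
Let piQ1 : pi Q1 = q - e. Proof. exact: (repB hO repO). Qed.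

Lemma exists_inner_representation : exists pi' : (H -> H) -> (X -> X),
    [/\ faithful_representation I pi', pi' idfun = pi idfun,
        pi' P1 = p - f & pi' Q1 = q - f].
Proof.
have [g0|[x0 gx0]] : g = 0 \/ exists x, g x <> 0.
  have [|ng] := pselect (exists x, g x <> 0); [by right|left].
  by apply/funext => x; apply: contra_notP ng => gx; exists x.
  exists pi; split=> //.
  - by split=> // T S; rewrite !inE => /IO OT /IO OS; apply: injO; rewrite inE.
  - by rewrite piP1; have /subr0_eq -> : f - e = 0 := g0.
  - by rewrite piQ1; have /subr0_eq -> : f - e = 0 := g0.
have N1 : ~ N idfun.
  apply: (@idfun_notin_generated (g x0)) => //.
    by rewrite -[LHS]/((pi P1 \o g) x0) p1g.
  by rewrite -[LHS]/((pi Q1 \o g) x0) q1g.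
have hN : cstar_subalgebra N.
  by apply: cstar_generated_subalgebra => T [->|->]; exact: projection_bounded.
pose chi T : R[i] := xget 0 [set k | scalar_part N T k].
have chiE T k : scalar_part N T k -> chi T = k.
  by move=> Tk; apply: (scalar_part_uniq hN N1 _ Tk); exact: (@xgetI _ 0 _ k).
have NP1 : N P1 by apply: sub_gen_smallest; left.
have NQ1 : N Q1 by apply: sub_gen_smallest; right.
(* The generators of the inner algebra have scalar parts 0, 0 and 1. *)
have chiI T : I T -> scalar_part N T (chi T).
  suff sub : I `<=` [set T | exists k, scalar_part N T k].
    by move=> /sub[k Tk]; rewrite (chiE T k).
  apply: smallest_sub; first exact: (unitization_subalgebra hN N1).
  move=> S [[->|->]|->]; [exists 0; exact: (scalar_part0 NP1)|exists 0; exact: (scalar_part0 NQ1)|].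
  by exists 1; exact: (scalar_part1 hN).
have rep : representation I (twist pi g chi).
  apply: twist_representation => //.
  - by move=> T S IT IS; apply: chiE; apply: (scalar_partD hN); exact: chiI.
  - by move=> k T IT; apply: chiE; apply: (scalar_partZ hN); exact: chiI.
  - by move=> T S IT IS; apply: chiE; apply: (scalar_partM hN); exact: chiI.
  - by move=> T S IT TS; apply: chiE; apply: (scalar_part_star hN _ TS); exact: chiI.
have twistE T k : scalar_part N T k -> forall x,
    twist pi g chi T x = pi T x - pi T (g x) + k *: g x.
  by move=> Tk x; rewrite /twist (chiE _ _ Tk).
exists (twist pi g chi); split.
- split=> // T S; rewrite !inE => IT IS TS.
  have IU : I (T - S) by exact: (csubB hI).
  have U0 : twist pi g chi (T - S) = 0 by rewrite (repB hI rep)// TS subrr.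
  have Ug x : pi (T - S) x = g (pi (T - S) x).
    exact: (twist_ker projg commute) IU U0.
  (* P1 and Q1 fix T - S on the left, since their images fix g. *)
  have absorb S1 : I S1 -> pi S1 \o g = g -> S1 \o (T - S) = T - S.
    move=> IS1 S1g; apply: injO.
    - exact: (mem_set (IO (csubM hI IS1 IU))).
    - exact: (mem_set (IO IU)).
    rewrite (repM repI)//; apply/funext => x /=; rewrite Ug.
    by rewrite -[LHS]/((pi S1 \o g) (pi (T - S) x)) S1g.
  apply/funext => x; apply/eqP; rewrite -subr_eq0; apply/eqP.
  apply: reduced_ranges_disjoint.
    by rewrite -[RHS]/((T - S) x) -(absorb P1).
  by rewrite -[RHS]/((T - S) x) -(absorb Q1).
- apply/funext => x; rewrite (twistE _ 1 (scalar_part1 hN)) scale1r.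
  by rewrite -[pi idfun (g x)]/((pi idfun \o g) x) e1g subrK.
- apply/funext => x; rewrite (twistE _ 0 (scalar_part0 NP1)) scale0r addr0.
  rewrite -[pi P1 (g x)]/((pi P1 \o g) x) p1g piP1 /g !fctE.
  by rewrite opprB subrKA.
- apply/funext => x; rewrite (twistE _ 0 (scalar_part0 NQ1)) scale0r addr0.
  rewrite -[pi Q1 (g x)]/((pi Q1 \o g) x) q1g piQ1 /g !fctE.
  by rewrite opprB subrKA.
Qed.

End InnerOuter.

Theorem theorem4p5 (R : realType) (A : cstarAlgType R) (H : hilbertModType A)
    (P Q : H -> H) (hPQ : matched P Q)
    (X : hilbertType R) (pi : (H -> H) -> (X -> X))
    (hpi : faithful_representation (outer_algebra P Q) pi) :
  exists pi' : (H -> H) -> (X -> X),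
    [/\ faithful_representation (inner_algebra P Q) pi',
        pi' idfun = pi idfun,
        pi' (P - hmeet P Q) = pi P - xmeet (pi P) (pi Q) &
        pi' (Q - hmeet P Q) = pi Q - xmeet (pi P) (pi Q)].
Proof. exact: exists_inner_representation. Qed.
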